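(* Let $(P,\mathfrak{n},k)$ be a commutative noetherian local ring with $k$ algebraically closed, let $\pi\colon P\to R$ be a surjective homomorphism of rings whose kernel $I\subseteq\mathfrak n$ contains a $P$-regular element, and let $f_1,\dots,f_c$ be a minimal generating set of $I$. Let $P[\boldsymbol{s}]=P[s_1,\dots,s_c]$ be a polynomial ring, $\widetilde f:=\sum_{i=1}^{c}s_if_i$ and $\widetilde Q:=P[\boldsymbol{s}]/(\widetilde f)$. Fix an integer $d\geq \operatorname{depth}P$. Let $M$ be a finitely generated $R$-module, and let $J$ be the annihilator of the $k[\boldsymbol{s}]$-module $$\operatorname{Tor}_{d}^{\widetilde Q}(k[\boldsymbol{s}],M[\boldsymbol{s}])\oplus \operatorname{Tor}_{d+1}^{\widetilde Q}(k[\boldsymbol{s}],M[\boldsymbol{s}]).$$ If $\operatorname{proj\,dim}_P M=\infty$, then $\mathcal{V}_\pi(M)=k^c$. Otherwise $$\mathcal{V}_\pi(M)=\{(a_1,\dots,a_c)\in k^c\mid h(a_1,\dots,a_c)=0\text{ for all polynomials }h(\boldsymbol{s})\in J\}.$$ In particular, $\mathcal{V}_\pi(M)$ is a Zariski-closed subset of $k^c$.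
   Context: $M[\boldsymbol{s}]:=P[\boldsymbol{s}]\otimes_P M$; it is annihilated by $\widetilde f$ (since $IM=0$), hence is a $\widetilde Q$-module. The ring $k[\boldsymbol{s}]=P[\boldsymbol{s}]/\mathfrak{n}P[\boldsymbol{s}]$ is a $\widetilde Q$-algebra since $\widetilde f\in\mathfrak{n}P[\boldsymbol{s}]$. Homological support set: a lifting of $\boldsymbol{a}=(a_1,\dots,a_c)\in k^c$ is an element $\boldsymbol{a}'=(a'_1,\dots,a'_c)\in P^c$ such that $a'_i\equiv a_i \bmod \mathfrak{n}$ for each $i$ and $\sum_i a'_if_i$ is $P$-regular (not a zero divisor in $P$); every point of $k^c$ has a lifting. For a finitely generated $R$-module $M$, $$\mathcal{V}_\pi(M)=\Big\{\boldsymbol{a}\in k^c\ \Big|\ \text{there exists a lifting }\boldsymbol{a}'\text{ of }\boldsymbol{a}\text{ with }\operatorname{proj\,dim}_{P/(f)}M=\infty\text{ for }f=\sum_i a'_if_i\Big\}.$$ Here $M$ is viewed as a $P/(f)$-module via the surjection $P/(f)\to R$. (Whether $\operatorname{proj\,dim}_{P/(f)}M$ is infinite is independent of the chosen lifting.) The zero module has finite projective dimension. *)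

(* Defs.v *)
From HB Require Import structures.
From mathcomp Require Import all_boot all_order all_algebra.
From mathcomp Require Import generic_quotient ring_quotient.
From mathcomp Require Import boolp.
From mathcomp Require Import freeg mpoly.

Set Implicit Arguments.
Unset Strict Implicit.
Unset Printing Implicit Defensive.

Import GRing.Theory.
Local Open Scope ring_scope.
Local Open Scope quotient_scope.

Definition surjective (T U : Type) (g : T -> U) : Prop :=
  forall y, exists x, g x = y.

(** * Quotient modules *)

Section Span.
Variables (A : pzRingType) (L : lmodType A) (G : L -> Prop).

Inductive in_span : L -> Prop :=
| in_span0 : in_span 0
| in_span_step a g x : G g -> in_span x -> in_span (a *: g + x).

Definition span : pred L := fun x => `[< in_span x >].

Fact span_closed :
  zmod_closed span /\ (forall a, {in span, forall x, a *: x \in span}).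
Proof.
have spD x y : in_span x -> in_span y -> in_span (x + y).
  move=> hx hy; elim: hx => [|a g z Gg _ IH]; first by rewrite add0r.
  by rewrite -addrA; apply: in_span_step.
have spZ a x : in_span x -> in_span (a *: x).
  elim=> [|b g z Gg _ IH]; first by rewrite scaler0; constructor.
  by rewrite scalerDr scalerA; apply: in_span_step.
split; first split; first by apply/asboolP; constructor.
  move=> x y /asboolP hx /asboolP hy; apply/asboolP; apply: spD => //.
  by rewrite -scaleN1r; exact: spZ.
by move=> a x /asboolP hx; apply/asboolP; exact: spZ.
Qed.

HB.instance Definition _ := GRing.isZmodClosed.Build L span span_closed.1.

Lemma mem_span x : G x -> x \in span.
Proof.
move=> hx; apply/asboolP; rewrite -[x]addr0 -[x]scale1r.
by apply: in_span_step => //; constructor.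
Qed.

End Span.

Section QuotientModule.
Variables (A : pzRingType) (L : lmodType A) (G : L -> Prop).

Local Notation U := (GRing.ZmodClosed.clone L (span G) _).

(* L modulo the submodule generated by G *)
Definition quot_module : Type := Quotient.quot U.
HB.instance Definition _ := GRing.Zmodule.on quot_module.

Definition quot_module_pi (x : L) : quot_module := \pi_(Quotient.quot U) x.

Definition quot_module_repr (q : quot_module) : L :=
  repr (q : Quotient.quot U).

Lemma quot_module_piK (q : quot_module) :
  quot_module_pi (quot_module_repr q) = q.
Proof. exact: reprK. Qed.

Lemma quot_module_eqP x y :
  reflect (quot_module_pi x = quot_module_pi y) (x - y \in U).
Proof. by rewrite Quotient.idealrBE; exact: eqP. Qed.

Fact quot_module_pi_additive : zmod_morphism quot_module_pi.
Proof. by move=> x y; rewrite /quot_module_pi raddfB. Qed.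

Definition quot_module_scale (a : A) (q : quot_module) : quot_module :=
  quot_module_pi (a *: quot_module_repr q).

Lemma quot_module_scale_pi a x :
  quot_module_scale a (quot_module_pi x) = quot_module_pi (a *: x).
Proof.
apply/quot_module_eqP; rewrite -scalerBr (span_closed G).2 //.
by apply/quot_module_eqP; rewrite quot_module_piK.
Qed.

Let pi_add x y :
  quot_module_pi (x + y) = quot_module_pi x + quot_module_pi y.
Proof. by rewrite /quot_module_pi raddfD. Qed.

Fact quot_module_scaleA a b q :
  quot_module_scale a (quot_module_scale b q) = quot_module_scale (a * b) q.
Proof. by rewrite -[q]quot_module_piK !quot_module_scale_pi scalerA. Qed.

Fact quot_module_scale1 : left_id 1 quot_module_scale.
Proof. by move=> q; rewrite -[q]quot_module_piK quot_module_scale_pi scale1r. Qed.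

Fact quot_module_scaleDr : right_distributive quot_module_scale +%R.
Proof.
move=> a q r; rewrite -[q]quot_module_piK -[r]quot_module_piK -pi_add.
by rewrite !quot_module_scale_pi scalerDr pi_add.
Qed.

Fact quot_module_scaleDl q : {morph quot_module_scale^~ q : a b / a + b}.
Proof.
move=> a b; rewrite -[q]quot_module_piK !quot_module_scale_pi.
by rewrite scalerDl pi_add.
Qed.

HB.instance Definition _ := GRing.Zmodule_isLmodule.Build A quot_module
  quot_module_scaleA quot_module_scale1 quot_module_scaleDr quot_module_scaleDl.

HB.instance Definition _ := GRing.isZmodMorphism.Build L quot_module
  quot_module_pi quot_module_pi_additive.

Fact quot_module_pi_scalable : scalable quot_module_pi.
Proof. by move=> a x; rewrite -quot_module_scale_pi. Qed.

HB.instance Definition _ := GRing.isScalable.Build A L quot_module *:%R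
  quot_module_pi quot_module_pi_scalable.

End QuotientModule.

(** * The quotient of a commutative ring by a principal ideal *)

Section QuotientRing.
Variables (A : comPzRingType) (f : A).

Definition principal_ideal : pred A := fun x => `[< exists y, x = y * f >].

Fact principal_ideal_zmod_closed : zmod_closed principal_ideal.
Proof.
split; first by apply/asboolP; exists 0; rewrite mul0r.
move=> x y /asboolP [u ->] /asboolP [v ->]; apply/asboolP.
by exists (u - v); rewrite mulrBl.
Qed.

HB.instance Definition _ := GRing.isZmodClosed.Build A principal_ideal
  principal_ideal_zmod_closed.

Definition quot_ring : Type := Quotient.quot (GRing.ZmodClosed.clone A principal_ideal _).
HB.instance Definition _ := GRing.Zmodule.on quot_ring.

Definition quot_ring_pi (x : A) : quot_ring :=
  \pi_(Quotient.quot (GRing.ZmodClosed.clone A principal_ideal _)) x.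
Definition quot_ring_repr (q : quot_ring) : A :=
  repr (q : Quotient.quot (GRing.ZmodClosed.clone A principal_ideal _)).

Lemma quot_ring_reprK q : quot_ring_pi (quot_ring_repr q) = q.
Proof. exact: reprK. Qed.

Lemma quot_ring_eqP x y :
  quot_ring_pi x = quot_ring_pi y <-> exists z, x - y = z * f.
Proof.
split=> [/eqP|hz]; first by rewrite -Quotient.idealrBE => /asboolP.
by apply/eqP; rewrite -Quotient.idealrBE; apply/asboolP.
Qed.

Lemma quot_ring_reprP x : exists z, quot_ring_repr (quot_ring_pi x) = x + z * f.
Proof.
have [z hz] := (quot_ring_eqP _ _).1 (quot_ring_reprK (quot_ring_pi x)).
by exists z; rewrite -hz addrC subrK.
Qed.

Definition quot_ring_one : quot_ring := quot_ring_pi 1.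
Definition quot_ring_mul (q r : quot_ring) : quot_ring :=
  quot_ring_pi (quot_ring_repr q * quot_ring_repr r).

Lemma quot_ring_pi_mul x y :
  quot_ring_mul (quot_ring_pi x) (quot_ring_pi y) = quot_ring_pi (x * y).
Proof.
have [u hu] := quot_ring_reprP x; have [v hv] := quot_ring_reprP y.
apply/quot_ring_eqP; exists (x * v + u * (y + v * f)); rewrite hu hv.
rewrite [LHS]addrC mulrDl (mulrDr x) -addrA addKr [RHS]mulrDl mulrA.
by congr (_ + _); rewrite mulrAC.
Qed.

Let pi_add x y : quot_ring_pi (x + y) = quot_ring_pi x + quot_ring_pi y.
Proof. by rewrite /quot_ring_pi raddfD. Qed.

Fact quot_ring_mulA : associative quot_ring_mul.
Proof.
move=> x y z; rewrite -[x]quot_ring_reprK -[y]quot_ring_reprK.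
by rewrite -[z]quot_ring_reprK !quot_ring_pi_mul mulrA.
Qed.

Fact quot_ring_mulC : commutative quot_ring_mul.
Proof. by move=> x y; rewrite /quot_ring_mul mulrC. Qed.

Fact quot_ring_mul1 : left_id quot_ring_one quot_ring_mul.
Proof. by move=> x; rewrite -[x]quot_ring_reprK quot_ring_pi_mul mul1r. Qed.

Fact quot_ring_mulDl : left_distributive quot_ring_mul +%R.
Proof.
move=> x y z; rewrite -[x]quot_ring_reprK -[y]quot_ring_reprK.
by rewrite -[z]quot_ring_reprK -pi_add !quot_ring_pi_mul mulrDl pi_add.
Qed.

HB.instance Definition _ := GRing.Zmodule_isComPzRing.Build quot_ring
  quot_ring_mulA quot_ring_mulC quot_ring_mul1 quot_ring_mulDl.

Fact quot_ring_pi_zmod_morphism : zmod_morphism quot_ring_pi.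
Proof. by move=> x y; rewrite /quot_ring_pi raddfB. Qed.
HB.instance Definition _ := GRing.isZmodMorphism.Build A quot_ring
  quot_ring_pi quot_ring_pi_zmod_morphism.

Fact quot_ring_pi_monoid_morphism : monoid_morphism quot_ring_pi.
Proof. by split=> // x y; rewrite -quot_ring_pi_mul. Qed.
HB.instance Definition _ := GRing.isMonoidMorphism.Build A quot_ring
  quot_ring_pi quot_ring_pi_monoid_morphism.

Section Factor.
Variables (B : pzRingType) (phi : {rmorphism A -> B}) (phif : phi f = 0).

(* The ring homomorphism A/(f) -> B induced by phi : A -> B. *)
Definition quot_ring_factor (_ : phi f = 0) (q : quot_ring) : B :=
  phi (quot_ring_repr q).

Local Notation factor := (quot_ring_factor phif).

Lemma quot_ring_factor_pi x : factor (quot_ring_pi x) = phi x.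
Proof.
rewrite /quot_ring_factor; have [z ->] := quot_ring_reprP x.
by rewrite rmorphD rmorphM phif mulr0 addr0.
Qed.

Fact quot_ring_factor_zmod_morphism : zmod_morphism factor.
Proof.
move=> x y; rewrite -[x]quot_ring_reprK -[y]quot_ring_reprK -rmorphB.
by rewrite !quot_ring_factor_pi rmorphB.
Qed.
HB.instance Definition _ := GRing.isZmodMorphism.Build quot_ring B
  factor quot_ring_factor_zmod_morphism.

Fact quot_ring_factor_monoid_morphism : monoid_morphism factor.
Proof.
split; first by rewrite quot_ring_factor_pi rmorph1.
move=> x y; rewrite -[x]quot_ring_reprK -[y]quot_ring_reprK -rmorphM.
by rewrite !quot_ring_factor_pi rmorphM.
Qed.
HB.instance Definition _ := GRing.isMonoidMorphism.Build quot_ring B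
  factor quot_ring_factor_monoid_morphism.

End Factor.

Section AnnihilatedModule.
Variables (L : lmodType A) (fL : forall x : L, f *: x = 0).

(* An A-module annihilated by f, viewed as a module over A/(f). *)
Definition over_quot (_ : forall x : L, f *: x = 0) : Type := L.
Local Notation L' := (over_quot fL).
HB.instance Definition _ := GRing.Zmodule.on L'.

Definition over_quot_scale (q : quot_ring) (x : L') : L' :=
  quot_ring_repr q *: (x : L).

Lemma over_quot_scale_pi a (x : L') :
  over_quot_scale (quot_ring_pi a) x = a *: (x : L).
Proof.
rewrite /over_quot_scale; have [z ->] := quot_ring_reprP a.
by rewrite scalerDl -scalerA fL scaler0 addr0.
Qed.

Fact over_quot_scaleA q r x :
  over_quot_scale q (over_quot_scale r x) = over_quot_scale (q * r) x.
Proof.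
rewrite -[q]quot_ring_reprK -[r]quot_ring_reprK -rmorphM.
by rewrite !over_quot_scale_pi scalerA.
Qed.

Fact over_quot_scale1 : left_id 1 over_quot_scale.
Proof. by move=> x; rewrite -[1]/(quot_ring_pi 1) over_quot_scale_pi scale1r. Qed.

Fact over_quot_scaleDr : right_distributive over_quot_scale +%R.
Proof. by move=> q x y; exact: scalerDr. Qed.

Fact over_quot_scaleDl x : {morph over_quot_scale^~ x : q r / q + r}.
Proof.
move=> q r; rewrite -[q]quot_ring_reprK -[r]quot_ring_reprK -rmorphD.
by rewrite !over_quot_scale_pi; exact: scalerDl.
Qed.

HB.instance Definition _ := GRing.Zmodule_isLmodule.Build quot_ring L'
  over_quot_scaleA over_quot_scale1 over_quot_scaleDr over_quot_scaleDl.

End AnnihilatedModule.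
End QuotientRing.

(** * Restriction and extension of scalars *)

Section Restriction.
Variables (A B : pzRingType) (phi : {rmorphism A -> B}) (M : lmodType B).

Definition restrict (_ : {rmorphism A -> B}) : Type := M.
Local Notation M' := (restrict phi).
HB.instance Definition _ := GRing.Zmodule.on M'.

Definition restrict_scale (a : A) (x : M') : M' := phi a *: (x : M).

Fact restrict_scaleA a b x :
  restrict_scale a (restrict_scale b x) = restrict_scale (a * b) x.
Proof. by rewrite /restrict_scale scalerA rmorphM. Qed.

Fact restrict_scale1 : left_id 1 restrict_scale.
Proof. by move=> x; rewrite /restrict_scale rmorph1; exact: scale1r. Qed.

Fact restrict_scaleDr : right_distributive restrict_scale +%R.
Proof. by move=> a x y; exact: scalerDr. Qed.

Fact restrict_scaleDl x : {morph restrict_scale^~ x : a b / a + b}.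
Proof. by move=> a b; rewrite /restrict_scale rmorphD; exact: scalerDl. Qed.

HB.instance Definition _ := GRing.Zmodule_isLmodule.Build A M'
  restrict_scaleA restrict_scale1 restrict_scaleDr restrict_scaleDl.
End Restriction.
Arguments restrict {A B} M phi.

Section FreeModuleLift.
Variables (A : nzRingType) (K : choiceType) (N : lmodType A) (g : K -> N).

Fact fglift_linear : linear (fglift g).
Proof.
have addP := @lift_is_additive A K N g.
pose h : {additive _ -> _} :=
  HB.pack (fglift g) (GRing.isZmodMorphism.Build _ _ (fglift g) addP).
have hE : fglift g =1 h by [].
have hD x y : fglift g (x + y) = fglift g x + fglift g y.
  by rewrite !hE raddfD.
have hZ a x : fglift g (a *: x) = a *: fglift g x.
  rewrite -[x]freeg_sumE scaler_sumr.
  rewrite !hE !(raddf_sum h) scaler_sumr; apply: eq_bigr => z _.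
  rewrite -!hE.
  have -> : a *: << coeff z x *g z >> = << a * coeff z x *g z >>.
    by apply/eqP/freeg_eqP => t; rewrite coeffZ !coeffU mulrA.
  by rewrite !liftU scalerA.
by move=> a x y; rewrite hD hZ.
Qed.
End FreeModuleLift.

Section BaseChange.
Variables (S : pzRingType) (A : comNzRingType) (phi : {rmorphism S -> A}).

(* A (x)_S L, for the S-algebra A: the free A-module on the symbols 1 (x) x,
   x in L, modulo the A-submodule generated by the relations
   1 (x) (x + y) = 1 (x) x + 1 (x) y and 1 (x) sx = phi(s) (x) x. *)
Inductive tensor_relation (L : lmodType S) : {freeg L / A} -> Prop :=
| TensorAdd x y : tensor_relation (<< x + y >> - << x >> - << y >>)
| TensorScale s x : tensor_relation (<< s *: x >> - phi s *: << x >>).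

Definition base_change (L : lmodType S) : lmodType A :=
  quot_module (@tensor_relation L).

(* x |-> 1 (x) x *)
Definition base_change_in (L : lmodType S) (x : L) : base_change L :=
  quot_module_pi (@tensor_relation L) << x >>.

Fact base_change_in_linear (L : lmodType S) :
  linear (@base_change_in L : L -> restrict (base_change L) phi).
Proof.
move=> s x y; rewrite /base_change_in.
transitivity (quot_module_pi (@tensor_relation L)
  (phi s *: << x >> + << y >>)); last by rewrite linearP.
apply/quot_module_eqP.
have -> : << s *: x + y >> - (phi s *: << x >> + << y >>) =
   (<< s *: x + y >> - << s *: x >> - << y >>) +
   (<< s *: x >> - phi s *: << x >>) :> {freeg L / A}.
  rewrite opprD [- (phi s *: _) - _]addrC !addrA.
  by rewrite [_ - << s *: x >> - _]addrAC subrK.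
by rewrite rpredD // mem_span //; constructor.
Qed.
HB.instance Definition _ (L : lmodType S) :=
  GRing.isLinear.Build S L (restrict (base_change L) phi) *:%R
    (@base_change_in L) (@base_change_in_linear L).

Lemma base_changeE (L : lmodType S) (q : base_change L) :
  q = \sum_(x <- dom (quot_module_repr q))
        coeff x (quot_module_repr q) *: base_change_in x.
Proof.
rewrite -[LHS]quot_module_piK -{1}[quot_module_repr q]freeg_sumE linear_sum.
apply: eq_bigr => x _; rewrite /base_change_in -linearZ; congr quot_module_pi.
by apply/eqP/freeg_eqP => t; rewrite coeffZ !coeffU mul1r.
Qed.

Section Universal.
Variables (L : lmodType S) (N : lmodType A) (g : {linear L -> restrict N phi}).

Definition base_change_lift (q : base_change L) : N :=
  fglift (g : L -> N) (quot_module_repr q).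

Lemma base_change_lift_pi x :
  base_change_lift (quot_module_pi _ x) = fglift (g : L -> N) x.
Proof.
pose h : {linear {freeg L / A} -> N} :=
  HB.pack (fglift (g : L -> N))
    (GRing.isLinear.Build _ _ _ _ (fglift (g : L -> N))
      (fglift_linear (g : L -> N))).
suff hker z : z \in span (@tensor_relation L) -> h z = 0.
  apply/eqP; rewrite -subr_eq0 -[_ - _]/(h _ - h _) -linearB; apply/eqP/hker.
  exact/quot_module_eqP/quot_module_piK.
have hU (u : L) : h << u >> = g u by rewrite /= liftU scale1r.
have hB v w : h (v - w) = h v - h w by exact: linearB.
have hZ a v : h (a *: v) = a *: h v by exact: linearZ.
move=> /asboolP; elim=> [|a u v hu _ IH]; first exact: linear0.
rewrite linearP IH addr0; case: hu => [{}x y|s {}x].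
  by rewrite !hB !hU (raddfD g) -addrA -opprD subrr scaler0.
rewrite hB hZ !hU (linearZZ g).
by rewrite -[s *: g x]/(phi s *: (g x : N)) subrr scaler0.
Qed.

Fact base_change_lift_linear : linear base_change_lift.
Proof.
move=> a x y; rewrite -[x]quot_module_piK -[y]quot_module_piK -linearP.
by rewrite !base_change_lift_pi; exact: fglift_linear.
Qed.
HB.instance Definition _ := GRing.isLinear.Build A (base_change L) N *:%R
  base_change_lift base_change_lift_linear.

Lemma base_change_lift_in x : base_change_lift (base_change_in x) = g x.
Proof. by rewrite base_change_lift_pi liftU scale1r. Qed.
End Universal.

(* id_A (x) g *)
Definition base_change_map (L L' : lmodType S) (g : {linear L -> L'}) :
    {linear base_change L -> base_change L'} :=
  @base_change_lift L (base_change L') (@base_change_in L' \o g).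

Lemma base_change_map_in (L L' : lmodType S) (g : {linear L -> L'}) x :
  base_change_map g (base_change_in x) = base_change_in (g x).
Proof. exact: base_change_lift_in. Qed.

End BaseChange.

(** * Projective resolutions, projective dimension and Tor *)

Definition projective (S : pzRingType) (F : lmodType S) : Prop :=
  forall (X Y : lmodType S) (p : {linear X -> Y}) (g : {linear F -> Y}),
    surjective p -> exists g' : {linear F -> X}, forall x, p (g' x) = g x.

Record projective_resolution (S : pzRingType) (N : lmodType S) := {
  term : nat -> lmodType S;
  diff : forall i, {linear term i.+1 -> term i};
  augm : {linear term 0 -> N};
  term_projective : forall i, projective (term i);
  augm_surjective : surjective augm;
  augm_exact : forall x, augm x = 0 <-> exists y, diff 0 y = x;
  diff_exact : forall i (x : term i.+1),
    diff i x = 0 <-> exists y, diff i.+1 y = x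
}.

Definition proj_dim_le (S : pzRingType) (N : lmodType S) (n : nat) : Prop :=
  exists F : projective_resolution N,
    forall i, (n < i)%N -> forall x : term F i, x = 0.

Definition finite_proj_dim (S : pzRingType) (N : lmodType S) : Prop :=
  exists n, proj_dim_le N n.

Section Homology.
Variables (A : pzRingType) (X Y Z : lmodType A).
Variables (d1 : {linear X -> Y}) (d0 : {linear Y -> Z}).

Definition cycle : pred Y := fun y => d0 y == 0.

Fact cycle_submod_closed : submod_closed cycle.
Proof.
split; first by rewrite /cycle unfold_in linear0.
move=> a x y; rewrite !unfold_in /cycle => /eqP hx /eqP hy.
by rewrite linearP hx hy scaler0 addr0.
Qed.
HB.instance Definition _ := GRing.isSubmodClosed.Build A Y cycle
  cycle_submod_closed.

Record cycles := Cycles { cycles_val :> Y; _ : cycles_val \in cycle }.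
HB.instance Definition _ := [isSub for cycles_val].
HB.instance Definition _ := [Choice of cycles by <:].
HB.instance Definition _ := [SubChoice_isSubZmodule of cycles by <:].
HB.instance Definition _ := [SubZmodule_isSubLmodule of cycles by <:].

(* ker d0 / im d1, for d0 \o d1 = 0 *)
Definition homology : lmodType A :=
  quot_module (fun z : cycles => exists x, d1 x = val z).
End Homology.

(* Tor^S_i(A, N), for an S-algebra A, as the A-module H_i(A (x)_S F), where F
   is a projective resolution of N over S. *)
Definition Tor (S : pzRingType) (A : comNzRingType) (phi : {rmorphism S -> A})
    (N : lmodType S) (F : projective_resolution N) (i : nat) : lmodType A :=
  let d j := base_change_map phi (diff F j) in
  match i with
  | 0 => homology (d 0) (\0 : base_change phi (term F 0) -> base_change phi (term F 0))
  | j.+1 => homology (d j.+1) (d j)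
  end.

Definition annihilator (A : pzRingType) (N : lmodType A) (a : A) : Prop :=
  forall x : N, a *: x = 0.

Definition fin_gen (A : pzRingType) (N : lmodType A) : Prop :=
  exists n (g : 'I_n -> N),
    forall x, exists r : 'I_n -> A, x = \sum_i r i *: g i.

(** * Commutative algebra *)

Definition is_ideal (A : comPzRingType) (I : A -> Prop) : Prop :=
  I 0 /\ forall a x y, I x -> I y -> I (a * x + y).

(* The ideal generated by the f i with i in D. *)
Definition ideal_gen (A : comPzRingType) (n : nat) (D : {set 'I_n})
    (f : 'I_n -> A) (x : A) : Prop :=
  exists r : 'I_n -> A, x = \sum_(i in D) r i * f i.

Definition noetherian (A : comPzRingType) : Prop :=
  forall I : A -> Prop, is_ideal I ->
    exists n (g : 'I_n -> A), forall x, I x <-> ideal_gen setT g x.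

Definition minimal_generators (A : comPzRingType) (I : A -> Prop) (n : nat)
    (f : 'I_n -> A) : Prop :=
  (forall x, I x <-> ideal_gen setT f x) /\
  (forall D : {set 'I_n}, D \proper setT ->
     ~ (forall x, I x <-> ideal_gen D f x)).

Lemma minimal_generators_in (A : comPzRingType) (I : A -> Prop) n
    (f : 'I_n -> A) : minimal_generators I f -> forall i, I (f i).
Proof.
move=> [hI _] i; apply/hI; exists (fun j => (j == i)%:R).
rewrite (bigD1 i) ?inE //= eqxx mul1r big1 ?addr0 // => j /andP [_ /negbTE ->].
by rewrite mul0r.
Qed.

(* P is local with maximal ideal the kernel of rho, and rho identifies its
   residue field with k. *)
Definition local_ring (P : comNzRingType) (k : fieldType)
    (rho : {rmorphism P -> k}) : Prop :=
  surjective rho /\ (forall x, rho x != 0 -> exists y, x * y = 1).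

(* xs`_i is a nonzerodivisor modulo the ideal generated by the previous terms,
   and the terms do not generate the unit ideal. *)
Definition regular_sequence (A : comPzRingType) (xs : seq A) : Prop :=
  let I m := ideal_gen setT (fun j : 'I_m => xs`_j) in
  (forall i y, (i < size xs)%N -> I i (xs`_i * y) -> I i y) /\
  ~ I (size xs) 1.

(* depth P is the maximal length of a regular sequence in the maximal ideal. *)
Definition is_depth (P : comNzRingType) (k : fieldType)
    (rho : {rmorphism P -> k}) (e : nat) : Prop :=
  let regular_in_n xs := regular_sequence xs /\ (forall x, x \in xs -> rho x = 0)
  in (exists2 xs, regular_in_n xs & size xs = e) /\
     (forall xs, regular_in_n xs -> (size xs <= e)%N).

(** * The homological support set *)

Section Support.
Variables (P R : comNzRingType) (k : fieldType).
Variables (rho : {rmorphism P -> k}) (pi : {rmorphism P -> R}).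
Variables (c : nat) (f : 'I_c -> P).

Definition lin_comb (a' : 'I_c -> P) : P := \sum_i a' i * f i.

Definition lifting (a : 'I_c -> k) (a' : 'I_c -> P) : Prop :=
  (forall i, rho (a' i) = a i) /\ GRing.lreg (lin_comb a').

Hypothesis fI : forall i, pi (f i) = 0.

Lemma lin_comb_ker a' : pi (lin_comb a') = 0.
Proof. by rewrite rmorph_sum big1 // => i _; rewrite rmorphM fI mulr0. Qed.

(* P/(sum_i a'_i f_i) -> R *)
Definition hypersurface_map (a' : 'I_c -> P) :
    {rmorphism quot_ring (lin_comb a') -> R} :=
  quot_ring_factor (lin_comb_ker a').

Definition support_set (M : lmodType R) (a : 'I_c -> k) : Prop :=
  exists a', lifting a a' /\
    ~ finite_proj_dim (restrict M (hypersurface_map a')).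

(** * The ring P[s]/(sum_i s_i f_i) *)

Definition ftilde : {mpoly P[c]} := \sum_i 'X_i * (f i)%:MP.
Definition Qtilde : comPzRingType := quot_ring ftilde.

Hypothesis fn : forall i, rho (f i) = 0.

Lemma ftilde_residue : map_mpoly rho ftilde = 0.
Proof.
rewrite rmorph_sum big1 // => i _.
have fi0 : map_mpoly rho (f i)%:MP_[c] = (rho (f i))%:MP_[c].
  exact: map_mpolyC.
by rewrite rmorphM /= fi0 fn mpolyC0 mulr0.
Qed.

Definition Qtilde_residue : {rmorphism Qtilde -> {mpoly k[c]}} :=
  quot_ring_factor ftilde_residue.

(* M[s] = P[s] (x)_P M *)
Definition poly_module (M : lmodType R) : lmodType {mpoly P[c]} :=
  base_change (@mpolyC c P) (restrict M pi).

Lemma ftilde_poly_module (M : lmodType R) (x : poly_module M) :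
  ftilde *: x = 0.
Proof.
have kill_in (m : restrict M pi) :
    ftilde *: base_change_in (@mpolyC c P) m = 0.
  rewrite /ftilde scaler_suml big1 // => i _; rewrite -scalerA.
  have -> : (f i)%:MP *: base_change_in (@mpolyC c P) m =
            base_change_in (@mpolyC c P) (f i *: m).
    by rewrite linearZ.
  rewrite (_ : f i *: m = 0) ?linear0 ?scaler0 //.
  by rewrite -[LHS]/(pi (f i) *: (m : M)) fI scale0r.
rewrite (base_changeE x) scaler_sumr big1 // => m _.
by rewrite scalerA mulrC -scalerA kill_in scaler0.
Qed.

Definition Qtilde_module (M : lmodType R) : lmodType Qtilde :=
  over_quot (@ftilde_poly_module M).

End Support.

Definition zariski_closed (k : fieldType) (c : nat) (V : ('I_c -> k) -> Prop) :
    Prop :=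
  exists Z : {mpoly k[c]} -> Prop, forall a, V a <-> forall h, Z h -> h.@[a] = 0.

(* The annihilator J of Tor_d (+) Tor_(d+1) over Qtilde of k[s] and M[s],
   computed from a projective resolution of M[s]. *)
Definition Tor_annihilator (P R : comNzRingType) (k : fieldType)
    (rho : {rmorphism P -> k}) (pi : {rmorphism P -> R}) (c : nat)
    (f : 'I_c -> P) (fI : forall i, pi (f i) = 0) (fn : forall i, rho (f i) = 0)
    (M : lmodType R) (F : projective_resolution (Qtilde_module fI M))
    (d : nat) : {mpoly k[c]} -> Prop :=
  annihilator
    (Tor (Qtilde_residue fn) F d * Tor (Qtilde_residue fn) F d.+1)%type.

(* Main.v *)
Require Import Defs.
From HB Require Import structures.
From mathcomp Require Import all_boot all_order all_algebra.
From mathcomp Require Import boolp.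
From mathcomp Require Import freeg mpoly.
From mathcomp Require Import zify.

Set Implicit Arguments.
Unset Strict Implicit.
Unset Printing Implicit Defensive.

Import GRing.Theory.
Local Open Scope ring_scope.

(** If pd_P M is infinite, then so is pd over every hypersurface P/(x) mapping
    onto R: lifting a finite free resolution over P/(x) to matrices d over P
    gives d d = x t, and the mapping cone of t is a finite free resolution of M
    over P.

    If pd_P M is finite, then the Auslander-Buchsbaum inequality bounds the
    length of a free resolution G of M over P by depth P <= d.  A system of
    higher homotopies on G[s] for ftilde is a square matrix B over P[s] with
    B B = ftilde, whose component of degree -1 is the differential of G.
    Truncating B gives Shamash's resolution of M[s] over P[s]/(ftilde);
    evaluating B at a lifting a' of a gives the analogous resolution of M over
    P/(f_a').  Both are 2-periodic in degrees >= d.  With Bk the reduction of B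
    modulo the maximal ideal, Bk Bk = 0, J is the annihilator of ker Bk / im Bk,
    and M has finite projective dimension over P/(f_a') iff Bk(a) is exact.

    It remains to compare Bk and Bk(a).  If h in J and h(a) <> 0, specialising the
    variables one at a time shows that Bk(a) is exact.  If Bk(a) is exact, it has
    a contracting homotopy S over k, and then det (Bk S + S Bk) is an element of J
    with value 1 at a. *)

(** * Comparison of projective resolutions *)

(** Finiteness of projective dimension is read off from Tor against the residue field. Over the
    local rings P and P/(f_a') minimal resolutions turn the vanishing of Tor in high degrees into
    finite length, but P[s]/(ftilde) is not local, so there Tor has to be computed from an explicit
    resolution. The matrix B serves both sides: its degree and parity conditions are entrywise and B
    B = ftilde is a polynomial identity, so both survive evaluation, and one B yields J as well as a
    resolution at every point.

    Two consecutive Tor modules occur because Bk exchanges even and odd degrees: each of them is the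
    half of ker Bk / im Bk of one parity. The bound on d ensures that the truncation no longer cuts
    anything off in these degrees.

    Evaluation at a is not flat, so exactness of Bk(a) does not follow by inverting an element h of
    J with h(a) <> 0; specialising one variable at a time replaces h by its square at each step,
    which still does not vanish at a. *)

Lemma dependent_choice (T : nat -> Type) (C : forall i, T i -> Prop)
    (R : forall i, T i -> T i.+1 -> Prop) :
  (exists t, C 0%N t) ->
  (forall i t, C i t -> exists2 t', R i t t' & C i.+1 t') ->
  exists t : forall i, T i, forall i, C i (t i) /\ R i (t i) (t i.+1).
Proof.
move=> /cid-[t0 C0] step.
have next i (s : {t : T i | C i t}) : {s' : {t : T i.+1 | C i.+1 t} |
    R i (sval s) (sval s')}.
  case: s => t Ct; have [t' Rt' Ct'] := cid2 (step i t Ct).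
  by exists (exist _ t' Ct').
pose s := fix s i : {t : T i | C i t} :=
  if i is j.+1 then sval (next j (s j)) else exist _ t0 C0.
exists (fun i => sval (s i)) => i; split; first exact: svalP (s i).
exact: svalP (next i (s i)).
Qed.

Lemma in_span_image (S : pzRingType) (X Y : lmodType S) (p : {linear X -> Y}) y :
  in_span (fun y => exists x, p x = y) y -> exists x, p x = y.
Proof.
elim=> [|a _ _ [x <-] _ [x' <-]]; first by exists 0; rewrite linear0.
by exists (a *: x + x'); rewrite linearP.
Qed.

Lemma mk_linear (S : pzRingType) (X Y : lmodType S) (f : X -> Y) :
  linear f -> {g : {linear X -> Y} | g =1 f}.
Proof.
move=> lf.
pose L := GRing.isLinear.Build _ _ _ _ f lf.
pose h : {linear X -> Y} := HB.pack f L.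
by exists h.
Qed.

Section Projective.
Variables (S : pzRingType).

(** Projectivity speaks of surjections only, so [p] is corestricted to its image, realised as the
    kernel [cycles q] of the projection [q] onto the cokernel of [p]. *)
Lemma projective_lift (F X Y : lmodType S) (p : {linear X -> Y})
    (g : {linear F -> Y}) :
  projective F -> (forall x, exists u, p u = g x) ->
  exists g' : {linear F -> X}, forall x, p (g' x) = g x.
Proof.
move=> projF pg.
pose q : {linear Y -> quot_module _} := quot_module_pi (fun y => exists x, p x
  = y).
have qp x : p x \in Defs.cycle q.
  apply/eqP; rewrite -[RHS](linear0 q); apply/quot_module_eqP; rewrite subr0.
  by apply: mem_span; exists x.
have qg x : g x \in Defs.cycle q by have [u <-] := pg x.
have cyc_im (y : cycles q) : exists x, p x = val y.
  apply: in_span_image; apply/asboolP; rewrite -[val y]subr0.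
  by apply/quot_module_eqP; rewrite [RHS]linear0; apply/eqP; exact: valP y.
have [p' p'E] : {h : {linear X -> cycles q} | forall x, val (h x) = p x}.
  have /mk_linear[h hE] : linear (fun x => Sub (p x) (qp x) : cycles q).
    by move=> a x y; apply/val_inj; rewrite /= linearP.
  by exists h => x; rewrite hE.
have [g1 g1E] : {h : {linear F -> cycles q} | forall x, val (h x) = g x}.
  have /mk_linear[h hE] : linear (fun x => Sub (g x) (qg x) : cycles q).
    by move=> a x y; apply/val_inj; rewrite /= linearP.
  by exists h => x; rewrite hE.
have [|g' g'E] := projF _ _ p' g1.
  by move=> y; have [x xE] := cyc_im y; exists x; apply/val_inj; rewrite p'E.
by exists g' => x; rewrite -p'E g'E g1E.
Qed.

Lemma diff_diff (N : lmodType S) (F : projective_resolution N) i x :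
  diff F i (diff F i.+1 x) = 0.
Proof. by apply/diff_exact; exists x. Qed.

Lemma chain_map (N : lmodType S) (F G : projective_resolution N) :
  exists u : forall i, {linear term F i -> term G i},
    (forall x, augm G (u 0%N x) = augm F x) /\
    (forall i x, diff G i (u i.+1 x) = u i (diff F i x)).
Proof.
(* The invariant is the solvability of the next lifting problem; degree 0 also records compatibility
   with the augmentations. *)
pose C i (t : {linear term F i -> term G i}) :=
  (forall x, exists y, diff G i y = t (diff F i x)) /\
  (match i return {linear term F i -> term G i} -> Prop with
   | 0 => fun t => forall x, augm G (t x) = augm F x | _ => fun=> True end t).
pose R i (t : {linear term F i -> term G i})
  (t' : {linear term F i.+1 -> term G i.+1}) :=
  forall x, diff G i (t' x) = t (diff F i x).
have [||u uP] := @dependent_choice _ C R.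
- have [|u uE] := @projective_lift _ _ _ (augm G) (augm F) (@term_projective _
  _ F 0%N).
    by move=> x; apply: augm_surjective.
  exists u; split=> // x; apply/augm_exact; rewrite uE.
  by apply/augm_exact; exists x.
- move=> i t [Ct _].
  have [u uE] := @projective_lift _ _ _ (diff G i) (t \o diff F i)
    (@term_projective _ _ F i.+1) Ct.
  exists u => //; split=> // x; apply/diff_exact; rewrite uE /=.
  by rewrite diff_diff linear0.
by exists u; split=> [|i]; [case: (uP 0%N) => -[] | case: (uP i)].
Qed.

Lemma chain_homotopy (N : lmodType S) (F G : projective_resolution N)
    (u v : forall i, {linear term F i -> term G i}) :
  (forall x, augm G (u 0%N x) = augm G (v 0%N x)) ->
  (forall i x, diff G i (u i.+1 x) = u i (diff F i x)) ->
  (forall i x, diff G i (v i.+1 x) = v i (diff F i x)) ->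
  exists s : forall i, {linear term F i -> term G i.+1},
    (forall x, u 0%N x - v 0%N x = diff G 0%N (s 0%N x)) /\
    (forall i x, u i.+1 x - v i.+1 x =
                   diff G i.+1 (s i.+1 x) + s i (diff F i x)).
Proof.
move=> uv0 du dv.
pose C i (t : {linear term F i -> term G i.+1}) :=
  (forall x, diff G i (t (diff F i x)) = (u i \- v i) (diff F i x)) /\
  (match i return {linear term F i -> term G i.+1} -> Prop with
   | 0 => fun t => forall x, u 0%N x - v 0%N x = diff G 0 (t x)
   | _ => fun=> True end t).
pose R i (t : {linear term F i -> term G i.+1})
  (t' : {linear term F i.+1 -> term G i.+2}) :=
  forall x, u i.+1 x - v i.+1 x = diff G i.+1 (t' x) + t (diff F i x).
have [||s sP] := @dependent_choice _ C R.
- have [|s sE] := @projective_lift _ _ _ (diff G 0%N) (u 0%N \- v 0%N)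
    (@term_projective _ _ F 0%N).
    by move=> x; apply/augm_exact; rewrite /= linearB uv0 subrr.
  by exists s; split=> // x; rewrite sE.
- move=> i t [Ct _].
  have [|s sE] := @projective_lift _ _ _ (diff G i.+1)
    ((u i.+1 \- v i.+1) \- (t \o diff F i)) (@term_projective _ _ F i.+1).
    move=> x; apply/diff_exact; rewrite /= linearB /= Ct /= linearB /=.
    by rewrite du dv subrr.
  exists s => [x|]; first by rewrite sE /= subrK.
  by split=> // x; rewrite sE /= diff_diff linear0 subr0.
by exists s; split=> [|i]; [case: (sP 0%N) => -[] | case: (sP i)].
Qed.

End Projective.

(** * Base change, and independence of Tor from the resolution *)

Section BaseChangeExt.
Variables (S : pzRingType) (A : comNzRingType) (phi : {rmorphism S -> A}).

Lemma base_change_inD (L : lmodType S) (x y : L) :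
  base_change_in phi (x + y) = base_change_in phi x + base_change_in phi y.
Proof. exact: (linearD (@base_change_in S A phi L)). Qed.

Lemma base_change_inZ (L : lmodType S) a (x : L) :
  base_change_in phi (a *: x) = phi a *: base_change_in phi x.
Proof.
have in0 : base_change_in phi (0 : L) = 0.
  by apply: (addrI (base_change_in phi 0)); rewrite -base_change_inD !addr0.
by have := base_change_in_linear phi a x 0; rewrite in0 !addr0.
Qed.

Lemma base_change_ext (L : lmodType S) (N : lmodType A)
    (g h : {linear base_change phi L -> N}) :
  (forall x, g (base_change_in phi x) = h (base_change_in phi x)) -> g =1 h.
Proof.
move=> gh q; rewrite (base_changeE q) !linear_sum; apply: eq_bigr => x _.
by rewrite !linearZ /= gh.
Qed.

Lemma annihilator_homology (X Y Z : lmodType A) (d1 : {linear X -> Y})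
    (d0 : {linear Y -> Z}) h :
  annihilator (homology d1 d0) h <->
  (forall y, d0 y = 0 -> exists x, d1 x = h *: y).
Proof.
split=> [hP y /eqP y0|hP q].
  pose z : cycles d0 := Sub y y0.
  have := hP (quot_module_pi _ z); rewrite -linearZ -[RHS](linear0
    (quot_module_pi _)).
  move/quot_module_eqP; rewrite subr0 => /asboolP.
  suff im w : in_span (fun z : cycles d0 => exists x, d1 x = val z) w ->
      exists x, d1 x = val w by move/im.
  elim=> [|a g x [u uE] _ [v vE]]; first by exists 0; rewrite linear0.
  by exists (a *: u + v); rewrite linearP uE vE.
rewrite -[q]quot_module_piK -linearZ -[RHS](linear0 (quot_module_pi _)).
apply/quot_module_eqP; rewrite subr0; apply: (@mem_span _ (cycles d0)).
by apply: hP; apply/eqP; exact: (valP (quot_module_repr q)).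
Qed.

Lemma annihilator_Tor (N : lmodType S) (F : projective_resolution N) i h :
  annihilator (Tor phi F i.+1) h <->
  (forall y, base_change_map phi (diff F i) y = 0 ->
     exists x, base_change_map phi (diff F i.+1) x = h *: y).
Proof. exact: annihilator_homology. Qed.

(** For comparison maps [u : G -> F] and [v : F -> G], the multiple h u(y) is a boundary in F, hence
    so is h v(u(y)) in G, and v u is homotopic to the identity. It allows J to be computed from any
    convenient resolution. *)
Lemma annihilator_Tor_indep (N : lmodType S) (F G : projective_resolution N)
    i h :
  annihilator (Tor phi F i.+1) h -> annihilator (Tor phi G i.+1) h.
Proof.
move=> /annihilator_Tor hF; apply/annihilator_Tor => y dy.
have [u [u0 du]] := chain_map G F; have [v [v0 dv]] := chain_map F G.
have [|||s [_ sE]] := @chain_homotopy _ _ G G (fun=> idfun)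
  (fun i => v i \o u i); rewrite //=.
- by move=> x; rewrite v0 u0.
- by move=> j x; rewrite dv du.
pose b := base_change_map phi.
have bE (L L' : lmodType S) (g : {linear L -> L'}) x :
  b _ _ g (base_change_in phi x) = base_change_in phi (g x).
  exact: base_change_map_in.
have uy : b _ _ (diff F i) (b _ _ (u i.+1) y) = 0.
  transitivity (b _ _ (u i) (b _ _ (diff G i) y)); last by rewrite dy linear0.
  apply: (base_change_ext (g := b _ _ (diff F i) \o b _ _ (u i.+1))
    (h := b _ _ (u i) \o b _ _ (diff G i))) => x.
  by rewrite /= !bE du.
have [x xE] := hF _ uy.
exists (b _ _ (v i.+2) x + h *: b _ _ (s i.+1) y).
rewrite linearD linearZ /=.
have -> : b _ _ (diff G i.+1) (b _ _ (v i.+2) x) =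
    b _ _ (v i.+1) (b _ _ (diff F i.+1) x).
  apply: (base_change_ext (g := b _ _ (diff G i.+1) \o b _ _ (v i.+2))
    (h := b _ _ (v i.+1) \o b _ _ (diff F i.+1))) => w.
  by rewrite /= !bE dv.
rewrite xE linearZ -scalerDr; congr (_ *: _).
transitivity (b _ _ (v i.+1) (b _ _ (u i.+1) y) +
  (b _ _ (diff G i.+1) (b _ _ (s i.+1) y) + b _ _ (s i) (b _ _ (diff G i) y))).
  by rewrite dy linear0 addr0.
apply: (base_change_ext (g := (b _ _ (v i.+1) \o b _ _ (u i.+1)) \+
  ((b _ _ (diff G i.+1) \o b _ _ (s i.+1)) \+ (b _ _ (s i) \o b _ _ (diff G i))))
  (h := idfun)) => w.
by rewrite /= !bE -!base_change_inD -sE addrC subrK.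
Qed.

End BaseChangeExt.

(** * Resolutions by matrices *)

Definition lin_val (S : pzRingType) (N : lmodType S) n (e : 'I_n -> N)
    (v : 'rV[S]_n) : N := \sum_i v 0 i *: e i.

Lemma lin_val_linear (S : pzRingType) (N : lmodType S) n (e : 'I_n -> N) :
  linear (lin_val e).
Proof.
move=> a u v; rewrite /lin_val scaler_sumr -big_split; apply: eq_bigr => i _ /=.
by rewrite !mxE scalerDl scalerA.
Qed.
HB.instance Definition _ (S : pzRingType) (N : lmodType S) n (e : 'I_n -> N) :=
  GRing.isLinear.Build S 'rV[S]_n N *:%R (lin_val e) (lin_val_linear e).

Lemma lin_val_delta (S : pzRingType) (N : lmodType S) n (e : 'I_n -> N) i :
  lin_val e (delta_mx 0 i) = e i.
Proof.
rewrite /lin_val (bigD1 i) //= mxE !eqxx scale1r big1 ?addr0 // => j ji.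
by rewrite mxE eqxx (negbTE ji) scale0r.
Qed.

Lemma lin_val_comp (S : pzRingType) (X Y : lmodType S) n (e : 'I_n -> X)
    (g : {linear X -> Y}) v : g (lin_val e v) = lin_val (g \o e) v.
Proof. by rewrite linear_sum; apply: eq_bigr => i _; rewrite linearZ. Qed.

Lemma row_projective (S : pzRingType) n : projective ('rV[S]_n : lmodType S).
Proof.
move=> X Y p g psurj.
have [e eE] := choice (fun i : 'I_n => psurj (g (delta_mx 0 i))).
exists (lin_val e) => v; rewrite lin_val_comp.
rewrite [in RHS](matrix_sum_delta v) big_ord1 linear_sum /lin_val.
by apply: eq_bigr => i _; rewrite linearZ /= eE.
Qed.

Record matrix_resolution (S : pzRingType) (N : lmodType S) (r : nat -> nat)
    (d : forall n, 'M[S]_(r n.+1, r n)) (e : 'I_(r 0) -> N) : Prop := {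
  mr_gen : surjective (lin_val e);
  mr_rel : forall v, lin_val e v = 0 <-> exists y, y *m d 0 = v;
  mr_exact : forall n (z : 'rV_(r n.+1)), z *m d n = 0 <-> exists y, y *m d
    n.+1 = z
}.

Section MatrixResolution.
Variables (S : pzRingType) (N : lmodType S) (r : nat -> nat).
Variables (d : forall n, 'M[S]_(r n.+1, r n)) (e : 'I_(r 0) -> N).
Hypothesis dP : matrix_resolution d e.

Definition row_resolution : projective_resolution N :=
  @Build_projective_resolution S N (fun n => 'rV[S]_(r n))
    (fun n => mulmxr (d n)) (lin_val e) (fun n => @row_projective S (r n))
    (mr_gen dP) (mr_rel dP) (mr_exact dP).

Lemma row_resolution_finite m : (forall n, (m < n)%N -> r n = 0) ->
  finite_proj_dim N.
Proof.
move=> r0; exists m, row_resolution => n mn x.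
by apply/rowP => i; have := ltn_ord i; rewrite [X in (_ < X)%N]r0.
Qed.

Lemma mulmx_diff n : d n.+1 *m d n = 0.
Proof.
apply/row_matrixP => i; rewrite row0 row_mul; apply/(mr_exact dP).
by exists (delta_mx 0 i); rewrite rowE.
Qed.

End MatrixResolution.

Section BaseChangeRow.
Variables (S : pzRingType) (A : comNzRingType) (phi : {rmorphism S -> A}).

Lemma base_change_row n :
  exists (g : {linear base_change phi 'rV[S]_n -> 'rV[A]_n})
         (g' : 'rV[A]_n -> base_change phi 'rV[S]_n),
    [/\ cancel g g', cancel g' g &
        forall x, g (base_change_in phi x) = map_mx phi x].
Proof.
have /mk_linear[m mE] :
    linear (map_mx phi : 'rV[S]_n -> restrict 'rV[A]_n phi).
  by move=> a x y; apply/matrixP => i j; rewrite !mxE rmorphD rmorphM.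
pose e (i : 'I_n) := base_change_in phi (delta_mx 0 i : 'rV[S]_n).
have [g gi] : exists g : {linear base_change phi 'rV[S]_n -> 'rV[A]_n},
    forall x, g (base_change_in phi x) = map_mx phi x.
  by exists (base_change_lift m) => x; rewrite -mE; exact: base_change_lift_in.
exists g, (lin_val e); split=> //.
- apply: (base_change_ext (g := lin_val e \o g) (h := idfun)) => x /=.
  rewrite gi [in RHS](matrix_sum_delta x) big_ord1 /lin_val.
  rewrite [RHS](big_morph _ (@base_change_inD _ _ phi _) (id1 := 0)).
    by apply: eq_bigr => i _; rewrite base_change_inZ mxE.
  by have := base_change_inZ phi 0 (0 : 'rV[S]_n); rewrite rmorph0 !scale0r.
- move=> v; rewrite lin_val_comp [RHS](matrix_sum_delta v) big_ord1.
  apply: eq_bigr => i _ /=; rewrite gi; congr (_ *: _).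
  by apply/matrixP => a b; rewrite !mxE rmorph_nat.
Qed.

Lemma annihilator_Tor_row (N : lmodType S) (r : nat -> nat)
    (d : forall n, 'M[S]_(r n.+1, r n)) (e : 'I_(r 0) -> N)
    (dP : matrix_resolution d e) n h :
  annihilator (Tor phi (row_resolution dP) n.+1) h <->
  (forall z : 'rV_(r n.+1), z *m map_mx phi (d n) = 0 ->
     exists y, y *m map_mx phi (d n.+1) = h *: z).
Proof.
have gd i (g : {linear base_change phi 'rV[S]_(r i.+1) -> 'rV[A]_(r i.+1)})
    (g1 : {linear base_change phi 'rV[S]_(r i) -> 'rV[A]_(r i)}) :
    (forall x, g (base_change_in phi x) = map_mx phi x) ->
    (forall x, g1 (base_change_in phi x) = map_mx phi x) ->
    forall q, g1 (base_change_map phi (mulmxr (d i)) q) =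
              g q *m map_mx phi (d i).
  move=> gi g1i q.
  apply: (base_change_ext (g := g1 \o base_change_map phi (mulmxr (d i)))
    (h := mulmxr (map_mx phi (d i)) \o g)) => x /=.
  by rewrite base_change_map_in g1i gi map_mxM.
have [g2 [g2' [g2K g2'K g2i]]] := base_change_row (r n.+2).
have [g1 [g1' [g1K g1'K g1i]]] := base_change_row (r n.+1).
have [g0 [g0' [g0K g0'K g0i]]] := base_change_row (r n).
rewrite annihilator_Tor; split=> [hP z dz|hP q dq].
  have [|x xE] := hP (g1' z).
    by apply: (can_inj g0K); rewrite (gd _ _ _ g1i g0i) g1'K dz linear0.
  exists (g2 x); rewrite -(gd _ _ _ g2i g1i).
  by rewrite [base_change_map _ _ _]xE linearZ /= g1'K.
have [|y yE] := hP (g1 q).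
  by rewrite -(gd _ _ _ g1i g0i) -[RHS](linear0 g0); congr (g0 _); exact: dq.
exists (g2' y); apply: (can_inj g1K).
by rewrite (gd _ _ _ g2i g1i) g2'K yE linearZ.
Qed.

(** Right exactness of base change. For the hard inclusion, a map back from the base change of N to
    the cokernel of [map_mx phi D] sends x to the class of any lift of x; it takes the image of v to
    the class of v. *)
Lemma base_change_presentation (N : lmodType S) m n (D : 'M[S]_(m, n))
    (e : 'I_n -> N) :
  surjective (lin_val e) ->
  (forall v, lin_val e v = 0 <-> exists y, y *m D = v) ->
  let e' i := base_change_in phi (e i) in
  surjective (lin_val e') /\
  (forall v, lin_val e' v = 0 <-> exists y, y *m map_mx phi D = v).
Proof.
move=> esurj erel e'.
have e'in v : lin_val e' (map_mx phi v) = base_change_in phi (lin_val e v).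
  rewrite [RHS](big_morph _ (@base_change_inD _ _ phi _) (id1 := 0)).
    by apply: eq_bigr => i _; rewrite mxE base_change_inZ.
  by have := base_change_inZ phi 0 (0 : N); rewrite rmorph0 !scale0r.
split.
  move=> q; have [v vE] := choice esurj.
  exists (\sum_(x <- dom (quot_module_repr q))
    coeff x (quot_module_repr q) *: map_mx phi (v x)).
  rewrite linear_sum [RHS]base_changeE; apply: eq_bigr => x _.
  by rewrite linearZ /= e'in vE.
have e'D : forall y, lin_val e' (y *m map_mx phi D) = 0.
  move=> y; transitivity (lin_val (fun i => lin_val e' (row i (map_mx phi D))) y).
    rewrite [y *m _]mulmx_sum_row linear_sum; apply: eq_bigr => i _.
    by rewrite linearZ.
  rewrite /lin_val big1 // => i _; rewrite -map_row -/(lin_val _ _) e'in.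
  rewrite (_ : lin_val e (row i D) = 0).
    have := base_change_inZ phi 0 (0 : N); rewrite rmorph0 !scale0r => ->.
    by rewrite scaler0.
  by apply/erel; exists (delta_mx 0 i); rewrite rowE.
move=> v; split=> [ev|[y <-] //].
pose G := fun w : 'rV[A]_n => exists y, mulmxr (map_mx phi D) y = w.
pose q : {linear _ -> _} := quot_module_pi G.
have [s sE] := choice esurj.
have qD (u w : 'rV[S]_n) : lin_val e u = lin_val e w ->
    q (map_mx phi u) = q (map_mx phi w).
  move=> uw; apply/quot_module_eqP; apply: mem_span.
  have [|y yE] := (erel (u - w)).1; first by rewrite linearB /= uw subrr.
  by exists (map_mx phi y); rewrite /= -map_mxM yE map_mxB.
have /mk_linear[t tE] :
    linear ((fun x => q (map_mx phi (s x))) : N -> restrict (quot_module G) phi).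
  move=> a x y.
  rewrite (qD _ (a *: s x + s y)); last by rewrite linearP /= !sE.
  by rewrite map_mxD map_mxZ linearP.
have tE' : forall w, base_change_lift t (lin_val e' w) = q w.
  move=> w; rewrite lin_val_comp [in RHS](matrix_sum_delta w) big_ord1 linear_sum.
  apply: eq_bigr => i _; rewrite linearZ /= base_change_lift_in tE.
  rewrite (qD _ (delta_mx 0 i)); last by rewrite sE lin_val_delta.
  congr (_ *: q _).
  by apply/matrixP => a b; rewrite !mxE rmorph_nat.
have qv : q v = 0 by rewrite -tE' ev linear0.
apply: (@in_span_image _ _ _ (mulmxr (map_mx phi D))).
apply/asboolP; rewrite -[v]subr0; apply/quot_module_eqP.
by rewrite [RHS]linear0.
Qed.

End BaseChangeRow.

(** * Noetherian local rings and minimal resolutions *)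

Section Noetherian.
Variables (A : comPzRingType).
Hypothesis A_noeth : noetherian A.

(** Induction on n: generators are lifts of generators of the ideal of first coordinates, together
    with generators of the vectors in U whose first coordinate is 0. *)
Lemma noetherian_submodule n (U : 'rV[A]_n -> Prop) :
  U 0 -> (forall a x y, U x -> U y -> U (a *: x + y)) ->
  exists m (K : 'M[A]_(m, n)), forall v, U v <-> exists y, y *m K = v.
Proof.
elim: n U => [|n IHn] U U0 UL.
  exists 0, 0 => v; split=> [_|_]; first by exists 0; apply/rowP => -[].
  by rewrite (_ : v = 0) //; apply/rowP => -[].
rewrite -[n.+1]/(1 + n)%N in U U0 UL *.
pose I x := exists2 v, U v & x = v 0 (lshift n 0).
have [|p [g gP]] := A_noeth (I := I).
  split=> [|a _ _ [v Uv ->] [w Uw ->]]; first by exists 0; rewrite ?mxE.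
  by exists (a *: v + w); [exact: UL | rewrite !mxE].
have Ig i : I (g i).
  apply/gP; exists (fun j => (j == i)%:R).
  rewrite (bigD1 i) ?inE //= eqxx mul1r big1 ?addr0 // => j /andP [_ /negbTE ->].
  by rewrite mul0r.
have [h hP] := choice (fun i => let: ex_intro2 v Uv gv := Ig i in
  ex_intro (fun v => U v /\ g i = v 0 (lshift n 0)) v (conj Uv gv)).
have [||m [K KP]] := IHn (fun w => U (row_mx 0 w)); first by rewrite row_mx0.
  by move=> a x y Ux Uy; have := UL a _ _ Ux Uy;
    rewrite scale_row_mx add_row_mx scaler0 addr0.
have Usum q (c : 'rV[A]_q) (M : 'M[A]_(q, 1 + n)) :
    (forall i, U (row i M)) -> U (c *m M).
  move=> UM; rewrite mulmx_sum_row; elim/big_rec: _ => // i x _; exact: UL.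
pose H := \matrix_(i < p) h i.
exists (p + m)%N, (col_mx H (row_mx 0 K)) => v; split=> [Uv|[y <-]].
  have [r rE] : ideal_gen setT g (v 0 (lshift n 0)) by apply/gP; exists v.
  pose c : 'rV[A]_p := \row_i r i.
  have cH : (c *m H) 0 (lshift n 0) = v 0 (lshift n 0).
    rewrite rE mxE; apply: eq_big => [i|i _]; first by rewrite inE.
    by rewrite !mxE (hP i).2.
  have UcH : U (c *m H) by apply: Usum => i; rewrite rowK; case: (hP i).
  have Uw : U (v - c *m H) by rewrite addrC -scaleN1r; exact: UL.
  have w0 : v - c *m H = row_mx 0 (rsubmx (v - c *m H)).
    rewrite -[LHS]hsubmxK; congr row_mx; apply/rowP => i.
    rewrite (ord1 i) mxE [LHS]mxE [X in _ + X]mxE cH addrN mxE //.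
  rewrite w0 in Uw; have [y yE] := (KP _).1 Uw.
  exists (row_mx c y); rewrite mul_row_col mul_mx_row mulmx0 yE -w0.
  by rewrite addrC subrK.
apply: Usum => i; rewrite -[i]splitK; case: (split i) => j /=.
  by rewrite rowKu rowK; case: (hP j).
rewrite rowKd row_row_mx row0; apply/KP.
by exists (delta_mx 0 j); rewrite rowE.
Qed.

Lemma noetherian_cycles (N : lmodType A) n (g : {linear 'rV[A]_n -> N}) :
  fin_gen (cycles g).
Proof.
have [||m [K KP]] := @noetherian_submodule n (fun v => g v = 0).
- exact: linear0.
- by move=> a x y gx gy; rewrite linearP gx gy scaler0 addr0.
have rK i : row i K \in Defs.cycle g.
  by apply/eqP/KP; exists (delta_mx 0 i); rewrite rowE.
exists m, (fun i => Sub (row i K) (rK i) : cycles g) => x.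
have [|y yE] := (KP (val x)).1; first by apply/eqP; exact: (valP x).
exists (y 0); apply: val_inj; rewrite -yE mulmx_sum_row.
rewrite (big_morph (val : cycles g -> _) (id1 := 0) (op1 := +%R)) //.
Qed.

(** The finitely many generators of the ideal spanned by all [z i] involve only finitely many of
    them. *)
Lemma noetherian_chain (z : nat -> A) :
  exists m (c : nat -> A), z m = \sum_(i < m) c i * z i.
Proof.
pose U x := exists m (c : nat -> A), x = \sum_(i < m) c i * z i.
have widen x m (c : nat -> A) M : (m <= M)%N -> x = \sum_(i < m) c i * z i ->
    exists c' : nat -> A, x = \sum_(i < M) c' i * z i.
  move=> mM ->; exists (fun i => if (i < m)%N then c i else 0).
  rewrite (big_ord_widen M (fun i => c i * z i)) // big_mkcond /=.
  by apply: eq_bigr => i _; case: ifP; rewrite ?mul0r.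
have [|n [g gP]] := A_noeth (I := U).
  split=> [|a x y [m [c xE]] [m' [c' yE]]].
    by exists 0%N, (fun=> 0); rewrite big_ord0.
  have [c1 ->] := widen _ _ _ _ (leq_maxl m m') xE.
  have [c2 ->] := widen _ _ _ _ (leq_maxr m m') yE.
  exists (maxn m m'), (fun i => a * c1 i + c2 i).
  rewrite mulr_sumr -big_split; apply: eq_bigr => i _ /=.
  by rewrite mulrDl mulrA.
have /choice[m mP] : forall i, U (g i).
  move=> i; apply/gP; exists (fun j => (j == i)%:R).
  rewrite (bigD1 i) ?inE //= eqxx mul1r big1 ?addr0 // => j /andP [_ /negbTE ->].
  by rewrite mul0r.
pose M := (\max_i m i)%N.
have /choice[c cP] : forall i, exists c : nat -> A, g i = \sum_(j < M) c j * z j.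
  by move=> i; have [c cE] := mP i; apply: widen cE; exact: leq_bigmax.
have [r rE] : ideal_gen setT g (z M).
  apply/gP; exists M.+1, (fun j => (j == M)%:R).
  rewrite big_ord_recr /= eqxx mul1r big1 ?add0r // => i _.
  by rewrite ltn_eqF ?mul0r.
exists M, (fun j => \sum_i r i * c i j); rewrite rE.
under eq_bigr do rewrite cP mulr_sumr.
rewrite exchange_big; apply: eq_bigr => j _; rewrite mulr_suml.
by apply: eq_big => [i|i _]; rewrite ?inE // mulrA.
Qed.

(* Elements z m killed by u + v^(m+1) but by no power of v behave like
   eigenvectors of u for the distinct eigenvalues -v^(m+1): they would generate
   a strictly increasing chain of ideals. *)
Lemma exists_regular_sum (u v : A) :
  (forall i, (0 < i)%N -> exists w, (1 - v ^+ i) * w = 1) ->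
  exists2 m, (0 < m)%N &
    forall z, (u + v ^+ m) * z = 0 -> exists n, v ^+ n * z = 0.
Proof.
move=> v_rad; apply: contrapT => nex.
have /choice[z zP] : forall m, exists z,
    (u + v ^+ m.+1) * z = 0 /\ forall n, v ^+ n * z != 0.
  move=> m; apply: contrapT => nz; apply: nex; exists m.+1 => // z uz.
  apply: contrapT => vz; apply: nz; exists z; split=> // n; apply/eqP => vn.
  by apply: vz; exists n.
have [m [c zm]] := noetherian_chain z.
(* The factor of index j kills [z j], so the product kills every earlier [z j] and therefore their
   combination [z m]. *)
have p0 : (\prod_(i < m) (u + v ^+ i.+1)) * z m = 0.
  rewrite zm mulr_sumr big1 // => j _; rewrite (bigD1 j) //=.
  by rewrite [X in X * _]mulrC mulrACA (zP j).1 mulr0.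
(* On [z m] the element u acts as [- v ^+ m.+1]. *)
have pE (s : seq 'I_m) : (\prod_(i <- s) (u + v ^+ i.+1)) * z m =
    (\prod_(i <- s) (v ^+ i.+1 - v ^+ m.+1)) * z m.
  elim: s => [|i s IHs]; first by rewrite !big_nil.
  rewrite !big_cons -!mulrA IHs mulrCA [RHS]mulrCA; congr (_ * _).
  apply/eqP; rewrite -subr_eq0 -mulrBl opprB addrAC -addrA subrK.
  by rewrite (zP m).1.
(* Each factor is [v ^+ i.+1] times the unit [1 - v ^+ (m - i)], so the product divides a power of
   v, which then kills [z m]: a contradiction. *)
have [w wE] : exists w, (\prod_(i < m) (v ^+ i.+1 - v ^+ m.+1)) * w =
    v ^+ (\sum_(i < m) i.+1).
  rewrite -prodrXr; elim: (index_enum _) => [|i s [w wE]].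
    by exists 1; rewrite !big_nil mul1r.
  have [|t tE] := v_rad (m - i)%N; first by rewrite subn_gt0.
  exists (t * w); rewrite !big_cons -wE mulrACA; congr (_ * _).
  have -> : v ^+ m.+1 = v ^+ i.+1 * v ^+ (m - i).
    by rewrite -exprD addSn subnKC // ltnW.
  by rewrite -{1}[v ^+ i.+1]mulr1 -mulrBr -mulrA tE mulr1.
have := (zP m).2 (\sum_(i < m) i.+1)%N.
by rewrite -wE (mulrC _ w) -mulrA -pE p0 mulr0 eqxx.
Qed.

End Noetherian.

Lemma noetherian_quot_ring (A : comPzRingType) (x : A) :
  noetherian A -> noetherian (quot_ring x).
Proof.
move=> An I [I0 IL].
have [|n [g gP]] := An (fun a => I (quot_ring_pi x a)).
  split=> [|a b b' Ib Ib']; first by rewrite rmorph0.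
  by rewrite rmorphD rmorphM; exact: IL.
exists n, (fun i => quot_ring_pi x (g i)) => q; rewrite -[q]quot_ring_reprK.
split=> [/gP[r ->]|[r ->]].
  exists (fun i => quot_ring_pi x (r i)); rewrite rmorph_sum.
  by apply: eq_bigr => i _; rewrite rmorphM.
under eq_bigr do rewrite -[r _]quot_ring_reprK -rmorphM.
by rewrite -rmorph_sum; apply/gP; eexists.
Qed.

(** * Local rings: minimal resolutions and regular elements *)

Section Local.
Variables (A : comPzRingType) (k : fieldType) (rho : {rmorphism A -> k}).
Hypothesis A_local : forall x, rho x != 0 -> exists y, x * y = 1.

Lemma local_rad v i : rho v = 0 -> (0 < i)%N -> exists w, (1 - v ^+ i) * w = 1.
Proof.
move=> v0 i0; apply: A_local.
by rewrite rmorphB rmorph1 rmorphXn v0 expr0n eqn0Ngt i0 subr0 oner_neq0.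
Qed.

(** With the number of generators minimal, a relation having a unit coefficient would eliminate a
    generator. *)
Lemma minimal_generation (N : lmodType A) : fin_gen N ->
  exists n (e : 'I_n -> N), surjective (lin_val e) /\
    forall v, lin_val e v = 0 -> forall i, rho (v 0 i) = 0.
Proof.
move=> [n0 [g gP]].
pose gen n := `[< exists e : 'I_n -> N, surjective (lin_val e) >].
have exgen : exists n, gen n.
  exists n0; apply/asboolP; exists g => x; have [r ->] := gP x.
  by exists (\row_i r i); apply: eq_bigr => i _; rewrite mxE.
case: (ex_minnP exgen) => n /asboolP[e e_surj] n_min.
exists n, e; split=> // v ev i; apply/eqP/negPn/negP => /A_local[y vy].
case: n => [|n] in e e_surj n_min v ev i vy *; first by case: i {vy}.
suff /n_min : gen n by rewrite ltnn.
apply/asboolP; exists (e \o fintype.lift i) => x; have [u uE] := e_surj x.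
pose u' := u - (u 0 i * y) *: v.
have ui : u' 0 i = 0 by rewrite !mxE -mulrA (mulrC y) vy mulr1 subrr.
exists (\row_j u' 0 (fintype.lift i j)).
have <- : lin_val e u' = x by rewrite linearB linearZ /= ev scaler0 subr0.
rewrite [RHS](bigD1_ord i) //= ui scale0r add0r.
by apply: eq_bigr => j _; rewrite mxE.
Qed.

Hypothesis A_noeth : noetherian A.

Lemma minimal_resolution (N : lmodType A) : fin_gen N ->
  exists (r : nat -> nat) (d : forall n, 'M[A]_(r n.+1, r n)) (e : 'I_(r 0) -> N),
    matrix_resolution d e /\ forall n i j, rho (d n i j) = 0.
Proof.
move=> /minimal_generation[r0 [e [e_surj e_min]]].
have ker (X : lmodType A) n (g : {linear 'rV[A]_n -> X}) :
    {m & {K : 'M[A]_(m, n) |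
      (forall z, g z = 0 <-> exists y, y *m K = z) /\
      (forall y : 'rV_m, y *m K = 0 -> forall i, rho (y 0 i) = 0)}}.
  have /cid[m /cid[c [c_surj c_min]]] := minimal_generation (noetherian_cycles
    A_noeth g).
  have valE y : y *m (\matrix_i val (c i)) = val (lin_val c y).
    rewrite mulmx_sum_row /lin_val (big_morph (val : cycles g -> _) (id1 := 0)
      (op1 := +%R)) //.
    by apply: eq_bigr => i _; rewrite rowK.
  exists m, (\matrix_i val (c i)); split=> [z|y].
    split=> [/eqP gz|[y <-]]; last by rewrite valE;
      apply/eqP/(valP (lin_val c y)).
    by have [y yE] := c_surj (Sub z gz : cycles g); exists y; rewrite valE yE.
  by rewrite valE => y0; apply: c_min; apply: val_inj.
(* The state holds two consecutive ranks and the matrix between them, so that [d n] has the required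
   type by conversion. *)
pose T := {n : nat & {m : nat & 'M[A]_(m, n)}}.
pose next (s : T) : T := existT _ (projT1 (projT2 s))
  (existT _ _ (sval (projT2 (ker _ _ (mulmxr (projT2 (projT2 s))))))).
pose s := fix s n : T := if n is m.+1 then next (s m) else
  existT _ r0 (existT _ _ (sval (projT2 (ker _ _ (lin_val e))))).
pose r n := projT1 (s n).
pose d n : 'M[A]_(r n.+1, r n) := projT2 (projT2 (s n)).
have d_ker n (z : 'rV_(r n.+1)) : z *m d n = 0 <-> exists y, y *m d n.+1 = z.
  exact: (svalP (projT2 (ker _ _ (mulmxr (d n))))).1.
have d_min n (z : 'rV_(r n.+1)) : z *m d n = 0 -> forall i, rho (z 0 i) = 0.
  case: n z => [|n].
    exact: (svalP (projT2 (ker _ _ (lin_val e)))).2.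
  exact: (svalP (projT2 (ker _ _ (mulmxr (d n))))).2.
have e_ker : forall v, lin_val e v = 0 <-> exists y, y *m d 0 = v.
  exact: (svalP (projT2 (ker _ _ (lin_val e)))).1.
exists r, d, e; split=> // n i j.
have -> : d n i j = (row i (d n)) 0 j by rewrite mxE.
case: n => [|n] in i j *.
  by apply: e_min; apply/e_ker; exists (delta_mx 0 i); rewrite rowE.
by apply: (d_min n); apply/d_ker; exists (delta_mx 0 i); rewrite rowE.
Qed.

(* k (x) d = 0 for minimal d, so k (x)_A 'rV_(r n) is Tor_n(k, N). *)
Lemma minimal_resolution_Tor (N : lmodType A) (r : nat -> nat)
    (d : forall n, 'M[A]_(r n.+1, r n)) (e : 'I_(r 0) -> N) n
    (F : projective_resolution N) :
  matrix_resolution d e -> (forall n i j, rho (d n i j) = 0) ->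
  annihilator (Tor rho F n.+1) 1 -> r n.+1 = 0%N.
Proof.
move=> dP d_min /(annihilator_Tor_indep (G := row_resolution dP)).
have d0 m : map_mx rho (d m) = 0 by apply/matrixP => i j; rewrite !mxE d_min.
move/annihilator_Tor_row => /(_ (const_mx 1)); rewrite !d0 mulmx0.
move=> /(_ erefl)[y]; rewrite mulmx0 scale1r.
case: (r n.+1) => // m /matrixP/(_ 0 0); rewrite !mxE => /esym/eqP.
by rewrite oner_eq0.
Qed.

Lemma finite_proj_dim_Tor (N : lmodType A) (F : projective_resolution N) :
  finite_proj_dim N ->
  exists m, forall n, (m <= n)%N -> annihilator (Tor rho F n.+1) 1.
Proof.
move=> [m [G G0]]; exists m => n mn.
apply: (annihilator_Tor_indep (F := G)); apply/annihilator_Tor => y _.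
exists 0; rewrite linear0 scale1r (base_changeE y) big1 // => x _.
rewrite (G0 n.+1 _ x) //.
have := base_change_inZ rho 0 (0 : term G n.+1).
by rewrite rmorph0 !scale0r => ->; rewrite scaler0.
Qed.

(** A substitute for prime avoidance, by induction on [ys]: w is replaced by [w + y ^+ m]. If this
    kills z, then a power of y kills z, and since w z = - y^m z a power of w does too, so the
    induction hypothesis applies. *)
Lemma list_nilpotent (ys : seq A) : (forall y, y \in ys -> rho y = 0) ->
  exists2 w, rho w = 0 & forall z, w * z = 0 ->
    forall y, y \in ys -> exists n, y ^+ n * z = 0.
Proof.
elim: ys => [_|y ys IHys ysP]; first by exists 0; rewrite ?rmorph0.
have [|w w0 wP] := IHys.
  by move=> x xys; apply: ysP; rewrite inE xys orbT.
have y0 : rho y = 0 by apply: ysP; rewrite mem_head.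
have [|m m0 mP] := exists_regular_sum A_noeth w (v := y).
  by move=> i; exact: local_rad.
exists (w + y ^+ m) => [|z wyz].
  by rewrite rmorphD rmorphXn w0 y0 expr0n eqn0Ngt m0 addr0.
have [n yz] := mP z wyz.
move=> x; rewrite inE => /orP[/eqP ->|xys]; first by exists n.
have wz : w ^+ n * z = 0.
  have wyE i : w ^+ i * z = (- 1) ^+ i * (y ^+ (m * i) * z).
    elim: i => [|i IHi]; first by rewrite muln0 !expr0 !mul1r.
    rewrite exprS -mulrA IHi mulrCA (mulrCA w) exprS mulnS exprD -!mulrA.
    have -> : w * z = - (y ^+ m * z).
      by apply/eqP; rewrite -addr_eq0 -mulrDl wyz.
    by rewrite mulN1r !mulrN (mulrCA (y ^+ (m * i))).
  rewrite wyE (_ : (m * n = n + (m * n - n))%N).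
    by rewrite exprD mulrAC yz mul0r mulr0.
  by rewrite subnKC // leq_pmull.
have {wz}: exists j, w ^+ n * (x ^+ j * z) = 0.
  by exists 0%N; rewrite expr0 mul1r.
(* The factors w are removed one at a time, each at the cost of a further power of x. *)
elim: n {yz} => [|n IHn] [j]; first by rewrite mul1r; exists j.
rewrite exprS -mulrA => /wP/(_ _ xys)[l xl]; apply: IHn; exists (l + j)%N.
by rewrite exprD -mulrA mulrCA.
Qed.

(** Take w from [list_nilpotent] for generators of the maximal ideal. If w killed some z <> 0, every
    generator would be nilpotent on z, and multiplying z by the largest powers of the generators
    that keep it nonzero would give a nonzero socle element. *)
Lemma exists_regular :
  (forall z, (forall x, rho x = 0 -> x * z = 0) -> z = 0) ->
  exists2 y, rho y = 0 & GRing.lreg y.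
Proof.
move=> no_soc.
have [|n [g gP]] := A_noeth (I := fun x => rho x = 0).
  split=> [|a x y x0 y0]; first exact: rmorph0.
  by rewrite rmorphD rmorphM x0 y0 mulr0 addr0.
have g0 i : rho (g i) = 0.
  apply/gP; exists (fun j => (j == i)%:R).
  rewrite (bigD1 i) ?inE //= eqxx mul1r big1 ?addr0 // => j /andP [_ /negbTE ->].
  by rewrite mul0r.
have [|w w0 wP] := @list_nilpotent [seq g i | i <- enum 'I_n].
  by move=> _ /mapP[i _ ->].
exists w => //; apply: mulrI0_lreg => z /wP wz; apply/eqP/negPn/negP => z0.
have [t tz0 tP] : exists2 t, t * z != 0 &
    forall y, y \in [seq g i | i <- enum 'I_n] -> y * (t * z) = 0.
  elim: [seq _ | _ <- _] wz => [|y ys IHys] ysP; first by exists 1;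
    rewrite ?mul1r.
  have [|t tz tP] := IHys; first by move=> x xys; apply: ysP;
    rewrite inE xys orbT.
  have exn : exists n, y ^+ n * (t * z) == 0.
    have [|m mP] := ysP y; first exact: mem_head.
    by exists m; rewrite mulrCA mP mulr0.
  case: (ex_minnP exn) => -[|m] ym m_min; first by rewrite mul1r (negbTE tz) in
    ym.
  exists (y ^+ m * t) => [|x]; first by apply/negP; rewrite -mulrA => /m_min;
    rewrite ltnn.
  rewrite inE => /orP[/eqP ->|/tP xt]; first by rewrite !mulrA -exprS -mulrA
    (eqP ym).
  by rewrite -mulrA mulrCA xt mulr0.
move/eqP: tz0; apply; apply: no_soc => x /gP[r ->];
  rewrite mulr_suml big1 // => i _.
by rewrite -mulrA tP ?mulr0 //; apply/mapP; exists i; rewrite ?mem_enum.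
Qed.

End Local.

(** * The Auslander-Buchsbaum inequality and change of rings *)

Lemma quot_ring_pi0 (A : comPzRingType) (y x : A) :
  quot_ring_pi y x = 0 <-> exists z, x = z * y.
Proof.
rewrite -[0](rmorph0 (quot_ring_pi y)) quot_ring_eqP.
by split=> -[z]; rewrite ?subr0 => E; exists z; rewrite ?subr0.
Qed.

Lemma map_mx_quot_ring (A : comPzRingType) (y : A) m n (M : 'M[A]_(m, n)) :
  map_mx (quot_ring_pi y) M = 0 <-> exists N : 'M[A]_(m, n), M = y *: N.
Proof.
split=> [M0|[N ->]]; last first.
  apply/matrixP => i j; rewrite !mxE; apply/quot_ring_pi0.
  by exists (N i j); rewrite mulrC.
have /choice[g gP] : forall p : 'I_m * 'I_n, exists z, M p.1 p.2 = z * y.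
  move=> p; apply/quot_ring_pi0.
  by move/matrixP: M0 => /(_ p.1 p.2); rewrite !mxE.
exists (\matrix_(i, j) g (i, j)); apply/matrixP => i j; rewrite !mxE.
by rewrite (gP (i, j)) mulrC.
Qed.

Definition mx_repr (A : comPzRingType) (y : A) m n (M : 'M[quot_ring y]_(m, n)) :
  'M[A]_(m, n) := map_mx (@quot_ring_repr A y) M.

Lemma mx_reprK (A : comPzRingType) (y : A) m n (M : 'M[quot_ring y]_(m, n)) :
  map_mx (quot_ring_pi y) (mx_repr M) = M.
Proof. by apply/matrixP => i j; rewrite !mxE quot_ring_reprK. Qed.

Lemma scalemx_lreg (A : comPzRingType) (y : A) m n (M N : 'M[A]_(m, n)) :
  GRing.lreg y -> y *: M = y *: N -> M = N.
Proof.
by move=> yreg /matrixP MN; apply/matrixP => i j; apply: yreg; have := MN i j;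
  rewrite !mxE.
Qed.

Section QuotientLocal.
Variables (A : comPzRingType) (k : fieldType) (rho : {rmorphism A -> k}).
Hypothesis A_local : forall x, rho x != 0 -> exists y, x * y = 1.
Variables (y : A) (rho_y : rho y = 0).

Lemma quot_ring_local (q : quot_ring y) : quot_ring_factor rho_y q != 0 ->
  exists q', q * q' = 1.
Proof.
rewrite -[q]quot_ring_reprK quot_ring_factor_pi => /A_local[z qz].
by exists (quot_ring_pi y z); rewrite -rmorphM qz rmorph1.
Qed.

End QuotientLocal.

(** By [key], the ideal of y and the first i lifts is the preimage of the ideal of the first i terms
    of [xs]; regularity transfers along this, and index 0 is the regularity of y. *)
Lemma regular_sequence_cons (A : comPzRingType) (y : A) (xs : seq (quot_ring y)) :
  GRing.lreg y -> regular_sequence xs ->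
  regular_sequence (y :: map (@quot_ring_repr A y) xs).
Proof.
move=> yreg [xs_reg xs1].
set ys := y :: _.
have pi_ys j : quot_ring_pi y (ys`_j.+1) = xs`_j.
  rewrite /ys /=; have [jx|jx] := ltnP j (size xs).
    by rewrite (nth_map 0) // quot_ring_reprK.
  by rewrite !nth_default ?size_map // rmorph0.
have key i a : ideal_gen setT (fun j : 'I_i.+1 => ys`_j) a <->
    ideal_gen setT (fun j : 'I_i => xs`_j) (quot_ring_pi y a).
  split=> -[r rE].
    exists (fun j => quot_ring_pi y (r (fintype.lift ord0 j))).
    have E j : (j \in [set: 'I_i.+1]) = true by rewrite inE.
    rewrite rE (eq_bigl _ _ E) big_ord_recl rmorphD rmorphM /=.
    rewrite (_ : quot_ring_pi y y = 0) ?mulr0 ?add0r; last first.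
      by apply/quot_ring_pi0; exists 1; rewrite mul1r.
    rewrite rmorph_sum; apply: eq_big => [j|j _]; first by rewrite inE.
    by rewrite rmorphM -pi_ys.
  pose s := \sum_(j in [set: 'I_i]) quot_ring_repr (r j) * ys`_j.+1.
  have [z zE] : exists z, a - s = z * y.
    apply/quot_ring_eqP; rewrite rE rmorph_sum; apply: eq_bigr => j _.
    by rewrite rmorphM /= quot_ring_reprK -pi_ys.
  exists (fun j => oapp (fun j => quot_ring_repr (r j)) z (unlift ord0 j)).
  have E j : (j \in [set: 'I_i.+1]) = true by rewrite inE.
  rewrite (eq_bigl _ _ E) big_ord_recl /= unlift_none /= -zE.
  under eq_bigr do rewrite liftK /=.
  rewrite (_ : \sum_(j < i) _ = s) ?subrK //.
  by apply: eq_bigl => j; rewrite inE.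
split; last by move=> h; apply: xs1; move: h; rewrite /= size_map => /key;
  rewrite rmorph1.
move=> [|i] a ilt.
  move=> [r]; rewrite big1 => [/= ya|[]//]; exists r; rewrite big1 => [|[]//].
  by apply: yreg; rewrite ya mulr0.
move=> /key; rewrite rmorphM /= -/(ys`_i.+1) pi_ys => /xs_reg h; apply/key/h.
by move: ilt; rewrite /= size_map ltnS.
Qed.

(* A socle element of the ring would give a cycle in degree L, so for L > 0 there
   is a regular element; reduce modulo it, dropping the lowest term. *)
Lemma auslander_buchsbaum (k : fieldType) (L : nat) (A : comPzRingType)
    (rho : {rmorphism A -> k}) (r : nat -> nat)
    (d : forall n, 'M[A]_(r n.+1, r n)) :
  noetherian A -> (forall x, rho x != 0 -> exists y, x * y = 1) ->
  (forall n (z : 'rV_(r n.+1)), z *m d n = 0 <-> exists y, y *m d n.+1 = z) ->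
  (0 < r L)%N -> r L.+1 = 0%N -> (forall n i j, rho (d n i j) = 0) ->
  exists xs : seq A, [/\ regular_sequence xs, forall x, x \in xs -> rho x = 0
                       & size xs = L].
Proof.
elim: L A rho r d => [|L IHL] A rho r d A_noeth A_local d_ex rL rL1 d_min.
  exists [::]; split=> //; split=> // -[g].
  rewrite big1 => [/(congr1 rho)/eqP|[]//].
  by rewrite rmorph1 rmorph0 oner_eq0.
have [|y y0 yreg] := exists_regular A_local A_noeth.
  move=> z z_soc; case rE: (r L.+1) => [//|n]; first by rewrite rE in rL.
  have i0 : 'I_(r L.+1) by rewrite rE; exact: ord0.
  have [|w wE] := (d_ex L (z *: delta_mx 0 i0)).1.
    rewrite -scalemxAl -rowE; apply/rowP => j; rewrite !mxE mulrC.
    by apply: z_soc; exact: d_min.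
  have w0 : w = 0 by apply/rowP => i; have := ltn_ord i;
    rewrite [X in (_ < X)%N]rL1.
  by move/rowP: wE => /(_ i0); rewrite w0 mul0mx !mxE !eqxx mulr1.
have [|||||n i j|xs [xs_reg xs0 xsL]] := IHL (quot_ring y) (quot_ring_factor y0)
    (fun n => r n.+1) (fun n => map_mx (quot_ring_pi y) (d n.+1)).
- exact: noetherian_quot_ring.
- by move=> q; exact: (quot_ring_local A_local).
(* Exactness modulo y: once degree 0 is dropped, the module resolved is the image of [d 0]. It lies
   in a free module, so y is regular on it, which might fail on the cokernel of [d 0]. *)
- have dd n : d n.+1 *m d n = 0.
    apply/row_matrixP => i; rewrite row0 row_mul; apply/d_ex.
    by exists (delta_mx 0 i); rewrite rowE.
  move=> n z; split=> [|[w <-]]; last by rewrite -mulmxA -map_mxM dd map_mx0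
    mulmx0.
  rewrite -[z]mx_reprK -map_mxM => /map_mx_quot_ring[w wE].
  have /d_ex[v vE] : w *m d n = 0.
    by apply: (scalemx_lreg yreg); rewrite scaler0 scalemxAl -wE -mulmxA dd
      mulmx0.
  have /d_ex[u uE] : (mx_repr z - y *: v) *m d n.+1 = 0.
    by rewrite mulmxBl wE -scalemxAl vE subrr.
  exists (map_mx (quot_ring_pi y) u); rewrite -map_mxM uE map_mxB.
  suff -> : map_mx (quot_ring_pi y) (y *: v) = 0 by rewrite subr0.
  by apply/map_mx_quot_ring; exists v.
- exact: rL.
- exact: rL1.
- by rewrite mxE -[RHS](d_min n.+1 i j); exact: quot_ring_factor_pi.
exists (y :: map (@quot_ring_repr A y) xs); split.
- exact: regular_sequence_cons.
- move=> x; rewrite inE => /orP[/eqP -> //|/mapP[q /xs0 q0 ->]].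
  exact: q0.
- by rewrite /= size_map xsL.
Qed.

Section ConeResolution.
Variables (A : comPzRingType) (x : A) (N : lmodType A) (N' : lmodType
  (quot_ring x)).
Variables (r : nat -> nat) (d : forall n, 'M[quot_ring x]_(r n.+1, r n)).
Variables (e' : 'I_(r 0) -> N') (e : 'I_(r 0) -> N).
Hypothesis x_reg : GRing.lreg x.
Hypothesis dP : matrix_resolution d e'.
Variable (iota : N' -> N).
Hypothesis iota_bij : bijective iota.
Hypothesis iotaE : forall v, lin_val e v = iota (lin_val e' (map_mx
  (quot_ring_pi x) v)).
Hypothesis iota0 : iota 0 = 0.

(* Lift d to matrices dl over A; then dl (n + 1) *m dl n = x *: t n and the
   mapping cone of t resolves N over A. *)
Lemma cone_resolution : exists (r' : nat -> nat)
    (d' : forall n, 'M[A]_(r' n.+1, r' n)) (e1 : 'I_(r' 0) -> N),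
  matrix_resolution d' e1 /\ forall n, r n = 0%N -> r n.+1 = 0%N -> r' n.+1 = 0%N.
Proof.
pose dl n := mx_repr (d n).
have /cid[t tE] : exists t : forall n, 'M[A]_(r n.+2, r n),
    forall n, dl n.+1 *m dl n = x *: t n.
  have tex n : exists t, dl n.+1 *m dl n = x *: t.
    by apply/map_mx_quot_ring; rewrite map_mxM !mx_reprK (mulmx_diff dP).
  by exists (fun n => sval (cid (tex n))) => n; case: cid.
have dt n : t n.+1 *m dl n = dl n.+2 *m t n.
  by apply: (scalemx_lreg x_reg); rewrite scalemxAl -tE scalemxAr -tE mulmxA.
pose r' n := if n is m.+1 then (r m.+1 + r m)%N else r 0%N.
(* The product of the lifted matrices with the Koszul complex of x, perturbed by [- t m] because the
   lifts compose to a multiple of x and not to 0. *)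
pose d' n : 'M[A]_(r' n.+1, r' n) := match n with
  | 0 => col_mx (dl 0%N) x%:M
  | m.+1 => block_mx (dl m.+1) (- t m) x%:M (- dl m)
  end.
exists r', d', e; split; last by move=> n /= -> ->.
have rel0 v : lin_val e v = 0 <-> exists y, y *m d' 0%N = v.
  have -> : lin_val e v = 0 <-> lin_val e' (map_mx (quot_ring_pi x) v) = 0.
    rewrite iotaE; split=> [|->]; last exact: iota0.
    by rewrite -iota0 => /(bij_inj iota_bij).
  rewrite (mr_rel dP); split=> [[y yE]|[y <-]].
    have [w wE] : exists w, v - mx_repr y *m dl 0%N = x *: w.
      by apply/map_mx_quot_ring; rewrite map_mxB map_mxM !mx_reprK yE subrr.
    exists (row_mx (mx_repr y) w); rewrite /= mul_row_col mul_mx_scalar -wE.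
    by rewrite addrC subrK.
  exists (map_mx (quot_ring_pi x) (lsubmx (y : 'rV_(r 1%N + r 0%N)))).
  rewrite -(mx_reprK (d 0%N)) -map_mxM; apply/eqP; rewrite -subr_eq0 -map_mxB.
  apply/eqP/map_mx_quot_ring; exists (- rsubmx (y : 'rV_(r 1%N + r 0%N))).
  rewrite -{2}[y](@hsubmxK _ 1 (r 1%N) (r 0%N)) /= mul_row_col mul_mx_scalar.
  by rewrite opprD addrA subrr add0r scalerN.
have d'd' n : d' n.+1 *m d' n = 0.
  case: n => [|n] /=.
    by rewrite mul_block_col tE !mulNmx !mul_mx_scalar mul_scalar_mx !addrN
      col_mx0.
  rewrite mulmx_block !tE !mul_scalar_mx !mul_mx_scalar !mulNmx !mulmxN opprK.
  by rewrite dt ?scalerN tE !addrN !addNr block_mx0.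
(* The equation makes u a cycle modulo x, which determines the first block and, up to a multiple
   [x *: w], u itself; the second block is then verified after multiplication by x. *)
have left_ex n (u : 'rV_(r n.+1)) (v : 'rV_(r n)) : u *m dl n + x *: v = 0 ->
    exists y, y *m d' n.+1 = row_mx u v.
  move=> uv.
  have [|y yE] := (mr_exact dP (map_mx (quot_ring_pi x) u)).1.
    rewrite -(mx_reprK (d n)) -map_mxM; apply/map_mx_quot_ring; exists (- v).
    by rewrite scalerN; apply/eqP; rewrite -addr_eq0 uv.
  have [w wE] : exists w, u - mx_repr y *m dl n.+1 = x *: w.
    by apply/map_mx_quot_ring; rewrite map_mxB map_mxM !mx_reprK yE subrr.
  exists (row_mx (mx_repr y) w); rewrite /= mul_row_block mul_mx_scalar -wE.
  rewrite subrKC; congr row_mx; apply: (scalemx_lreg x_reg).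
  rewrite !mulmxN scalerDr !scalerN !scalemxAl -wE -scalemxAl scalemxAr -tE
    mulmxA.
  rewrite mulmxBl opprB addKr.
  by apply/eqP; rewrite eq_sym -addr_eq0 addrC uv.
split=> //.
  move=> u; case: iota_bij => g iK gK; have [v vE] := mr_gen dP (g u).
  by exists (mx_repr v); rewrite iotaE mx_reprK vE gK.
move=> n z; split=> [zd|[y <-]]; last by rewrite -mulmxA d'd' mulmx0.
have [u [v zE]] : exists (u : 'rV_(r n.+1)) (v : 'rV_(r n)), z = row_mx u v.
  by exists (lsubmx z), (rsubmx z); rewrite hsubmxK.
rewrite zE in zd *; apply: left_ex.
case: n => [|n] in u v z zE zd *.
  by move: zd; rewrite /= mul_row_col mul_mx_scalar.
move: zd; rewrite /= mul_row_block -[0](@row_mx0 _ 1 (r n.+1) (r n)).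
by move/eq_row_mx => [+ _]; rewrite mul_mx_scalar.
Qed.
End ConeResolution.

(** An arbitrary preimage [a0] is corrected by a power of the regular element x of I. Taking v = x^2
    in [exists_regular_sum] leaves the odd power x^(2m-1) after one factor x is written as a
    combination of the f_i; as m > 0, the corrections x^(2m-1) r_i lie in the maximal ideal. With v
    = x and m = 1 they need not. *)
Lemma lifting_exists (P : comNzRingType) (k : fieldType) (rho : {rmorphism P ->
  k})
    (c : nat) (f : 'I_c -> P) (x : P) :
  noetherian P -> local_ring rho -> (forall i, rho (f i) = 0) ->
  GRing.lreg x -> ideal_gen setT f x -> forall a, exists a', lifting rho f a a'.
Proof.
move=> P_noeth [rho_surj P_local] f0 x_reg [r xE] a.
have [a0 a0E] := choice (fun i => rho_surj (a i)).
have xs : x = \sum_i r i * f i by rewrite xE; apply: eq_bigl => i; rewrite inE.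
have x0 : rho x = 0.
  by rewrite xs rmorph_sum big1 // => i _; rewrite rmorphM f0 mulr0.
have [|m m0 mP] := exists_regular_sum P_noeth (lin_comb f a0) (v := x ^+ 2).
  by move=> i; apply: (local_rad P_local); rewrite rmorphXn x0 expr0n.
exists (fun i => a0 i + x ^+ (m.*2.-1) * r i); split=> [i|].
  rewrite rmorphD rmorphM rmorphXn x0 expr0n a0E.
  by case: m m0 {mP} => // m _; rewrite mul0r addr0.
apply: mulrI0_lreg => z wz; have [|n xz] := mP z.
  rewrite -[RHS]wz; congr (_ * _).
  rewrite [RHS](eq_bigr (fun i => a0 i * f i + x ^+ (m.*2.-1) * (r i * f i))).
    rewrite big_split -mulr_sumr -xs -exprSr prednK ?double_gt0 //.
    by rewrite -exprM mul2n.
  by move=> i _; rewrite mulrDl mulrA.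
by apply: (lregX (n := (2 * n)%N) x_reg); rewrite mulr0 exprM.
Qed.

(** * Bounded resolutions as graded square matrices *)

(* A bounded complex of free modules, assembled into a single square matrix T
   on a basis whose elements have degrees deg. *)
Record total_resolution (A : pzRingType) (N : lmodType A) (D n : nat)
    (deg : 'I_n -> nat) (T : 'M[A]_n) (e : 'I_n -> N) : Prop := {
  tr_deg : forall i, (deg i <= D)%N;
  tr_homog : forall i j, deg i != (deg j).+1 -> T i j = 0;
  tr_sq : T *m T = 0;
  tr_gen : surjective (lin_val e);
  tr_gen0 : forall i, deg i != 0%N -> e i = 0;
  tr_rel : forall v : 'rV_n, (forall j, deg j != 0%N -> v 0 j = 0) ->
    lin_val e v = 0 -> exists y, y *m T = v;
  tr_aug : forall y, lin_val e (y *m T) = 0;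
  tr_exact : forall z : 'rV_n, (forall j, deg j = 0%N -> z 0 j = 0) ->
    z *m T = 0 -> exists y, y *m T = z
}.

Section Total.
Variables (A : comPzRingType) (N : lmodType A) (r : nat -> nat).
Variables (d : forall n, 'M[A]_(r n.+1, r n)) (e : 'I_(r 0) -> N) (D : nat).
Hypothesis dP : matrix_resolution d e.
Hypothesis rD : forall n, (D < n)%N -> r n = 0%N.

Let n := (\sum_(i < D.+1) r i)%N.

(** Vectors are treated as families indexed by all naturals, so that degree shifts need no ordinals;
    the components beyond D are 0. *)
Let pack (w : forall m, 'rV[A]_(r m)) : 'rV[A]_n := \mxrow_(i < D.+1) w i.

Let row_r0 m (u : 'rV[A]_(r m)) : (D < m)%N -> u = 0.
Proof. by move=> /rD rm; apply/rowP => i; have := ltn_ord i;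
  rewrite [X in (_ < X)%N]rm. Qed.

Let unpack (z : 'rV[A]_n) : exists w, z = pack w.
Proof.
exists (fun m => match (m < D.+1)%N =P true with
  | ReflectT h => @submxrow A D.+1 (fun i : 'I_D.+1 => r i) 1 z (Ordinal h)
  | ReflectF _ => 0 end).
rewrite /pack -[LHS]submxrowK; apply/eq_mxrowP => -[i iD] /=.
by case: eqP => [h|//]; rewrite (eq_irrelevance h iD).
Qed.

Let pack_inj w w' : pack w = pack w' -> forall m, w m = w' m.
Proof.
move=> ww m; have [mD|] := leqP m D; last by move=> /row_r0 Z;
  rewrite (Z (w m)) (Z (w' m)).
pose i : 'I_D.+1 := Ordinal (mD : (m < D.+1)%N).
have blockE v : @submxrow A D.+1 (fun i : 'I_D.+1 => r i) 1 (pack v) i = v m.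
  exact: (@mxrowK A D.+1 (fun i : 'I_D.+1 => r i) 1 (fun i => v i) i).
by rewrite -!blockE ww.
Qed.

(** For ordinal block indices the equation [i = j.+1] is only propositional, whence the cast of
    [d j]. *)
Let Dm i j : 'M[A]_(r i, r j) := match i =P j.+1 with
  | ReflectT h => castmx (esym (congr1 r h), erefl) (d j)
  | ReflectF _ => 0 end.

Let DmE j : Dm j.+1 j = d j.
Proof.
rewrite /Dm; case: eqP => // h.
by rewrite (eq_irrelevance h erefl) castmx_id.
Qed.

Let Dm0 i j : i != j.+1 -> Dm i j = 0.
Proof. by rewrite /Dm; case: eqP. Qed.

Let T : 'M[A]_n := \mxblock_(i < D.+1, j < D.+1) Dm i j.

Let packM w : pack w *m T = pack (fun j => w j.+1 *m d j).
Proof.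
rewrite /pack /T mul_mxrow_mxblock; apply/eq_mxrowP => j.
have [jD|jD] := ltnP j.+1 D.+1.
  rewrite (bigD1 (Ordinal jD)) //= DmE big1 ?addr0 // => i ij.
  by rewrite Dm0 ?mulmx0.
rewrite (row_r0 (w j.+1)) // mul0mx big1 // => i _.
by rewrite Dm0 ?mulmx0 // ltn_eqF // (leq_trans (ltn_ord i)).
Qed.

Let deg (s : 'I_n) : nat := tagnat.sig1 s.

Let deg0 w : (forall s, deg s = 0%N -> (pack w) 0 s = 0) <-> w 0%N = 0.
Proof.
split=> [w0|w0 s].
  have := @mxrowK A D.+1 (fun i : 'I_D.+1 => r i) 1 (fun i => w i) ord0.
  move=> /= <-; apply/rowP => k; rewrite [LHS]mxE [RHS]mxE; apply: w0.
  by rewrite /deg tagnat.Rank1K.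
rewrite /deg /pack mxE; case: (tagnat.sig1 s) (tagnat.sig2 s) => m mD k /= m0.
by case: m m0 mD k => // _ mD k; rewrite w0 mxE.
Qed.

Let deg_pos w : (forall s, deg s != 0%N -> (pack w) 0 s = 0) <->
  forall m, w m.+1 = 0.
Proof.
split=> [w0 m|w0 s].
  have [mD|] := leqP m.+1 D; last exact: row_r0.
  pose i : 'I_D.+1 := Ordinal (mD : (m.+1 < D.+1)%N).
  have := @mxrowK A D.+1 (fun i : 'I_D.+1 => r i) 1 (fun i => w i) i.
  move=> /= <-; apply/rowP => k; rewrite [LHS]mxE [RHS]mxE; apply: w0.
  by rewrite /deg tagnat.Rank1K.
rewrite /deg /pack mxE; case: (tagnat.sig1 s) (tagnat.sig2 s) => m mD k /= m0.
by case: m m0 mD k => // m _ mD k; rewrite w0 mxE.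
Qed.

Lemma total_resolution_exists : exists n (deg : 'I_n -> nat) (T : 'M[A]_n)
  (e : 'I_n -> N), total_resolution D deg T e.
Proof.
pose first (z : 'rV[A]_n) : 'rV[A]_(r 0) :=
  @submxrow A D.+1 (fun i : 'I_D.+1 => r i) 1 z ord0.
have firstE w : first (pack w) = w 0%N.
  exact: (@mxrowK A D.+1 (fun i : 'I_D.+1 => r i) 1 (fun i => w i) ord0).
have first_lin : linear first by move=> a u v; apply/rowP => i; rewrite !mxE.
pose eT s := lin_val e (first (delta_mx 0 s)).
have eTE w : lin_val eT (pack w) = lin_val e (w 0%N).
  rewrite -firstE; have [g gE] := mk_linear first_lin.
  rewrite -gE [in RHS](matrix_sum_delta (pack w)) big_ord1 !linear_sum.
  by apply: eq_bigr => s _; rewrite !linearZ /= gE.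
exists n, deg, T, eT; split.
- by move=> s; rewrite -ltnS; exact: ltn_ord.
- by move=> s t st; rewrite mxE Dm0 // mxE.
- apply/row_matrixP => s; rewrite row0 row_mul rowE.
  have [w ->] := unpack (delta_mx 0 s); rewrite !packM.
  transitivity (pack (fun=> 0)); last exact: mxrow0.
  by apply/eq_mxrowP => i; rewrite -mulmxA (mulmx_diff dP) mulmx0.
- move=> x; have [v <-] := mr_gen dP x.
  pose w m := match m return 'rV[A]_(r m) with 0 => v | _ => 0 end.
  by exists (pack w); rewrite eTE.
- move=> s s0; rewrite -[eT s](lin_val_delta eT);
  have [w wE] := unpack (delta_mx 0 s).
  rewrite wE eTE (_ : w 0%N = 0) ?linear0 //; apply/deg0 => t t0.
  by rewrite -wE mxE eqxx; case: eqP => // ts; rewrite -ts t0 eqxx in s0.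
- move=> v; have [w ->] := unpack v => /deg_pos w0;
  rewrite eTE => /(mr_rel dP)[y yE].
  pose u m := match m return 'rV[A]_(r m) with 1 => y | _ => 0 end.
  exists (pack u); rewrite packM; apply/eq_mxrowP => -[[|i] iD] /=;
    first exact: yE.
  by rewrite w0 mul0mx.
- move=> y; have [u ->] := unpack y; rewrite packM eTE.
  by apply/(mr_rel dP); exists (u 1%N).
- move=> z; have [w ->] := unpack z => /deg0 w0; rewrite packM.
  rewrite (_ : 0 = pack (fun=> 0)); last exact/esym/mxrow0.
  move/pack_inj => wd.
  have yex j : exists y, y *m d j.+1 = w j.+1 by apply/(mr_exact dP).
  pose y j := sval (cid (yex j)).
  have yE j : y j *m d j.+1 = w j.+1 by rewrite /y; case: cid.
  pose u m := match m return 'rV[A]_(r m) with m'.+2 => y m' | _ => 0 end.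
  exists (pack u); rewrite packM; apply/eq_mxrowP => -[[|i] iD] /=.
    by rewrite mul0mx.
  exact: yE.
Qed.
End Total.

(** * Systems of higher homotopies *)

Section Homotopies.
Variables (A : comPzRingType) (n : nat) (deg : 'I_n -> nat).
Implicit Types (M : 'M[A]_n) (a b : nat).

(* All components of M of degree < a - b vanish, where the entry (i, j) of a
   matrix has degree deg j - deg i. *)
Definition deg_ge a b M := forall i j, (deg j + b < deg i + a)%N -> M i j = 0.

(** The component of degree a - b; a pair of naturals encodes the integer, since the differential
    has degree -1. *)
Definition deg_part a b M :=
  \matrix_(i, j) if (deg i + a == deg j + b)%N then M i j else 0.

Definition odd_degree M := forall i j, odd (deg i) = odd (deg j) -> M i j = 0.

Lemma deg_ge_mul a b a' b' M M' : deg_ge a b M -> deg_ge a' b' M' ->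
  deg_ge (a + a') (b + b') (M *m M').
Proof.
move=> hM hM' i j ij; rewrite mxE big1 // => k _.
have [ik|ik] := ltnP (deg k + b)%N (deg i + a)%N; first by rewrite hM ?mul0r.
by rewrite hM' ?mulr0 //; lia.
Qed.

(** Only the lowest components of the factors contribute to the lowest component of the product. *)
Lemma deg_part_mul a b a' b' M M' : deg_ge a b M -> deg_ge a' b' M' ->
  deg_part (a + a') (b + b') (M *m M') = deg_part a b M *m deg_part a' b' M'.
Proof.
move=> hM hM'; apply/matrixP => i j; rewrite !mxE.
rewrite -[LHS](_ : \sum_k (if (deg i + (a + a') == deg j + (b + b'))%N
   then M i k * M' k j else 0) = _); last by case: (_ == _)%N; rewrite ?big1_eq.
apply: eq_bigr => k _; rewrite !mxE.
case: (ltngtP (deg i + a) (deg k + b))%N => ik; last first.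
- case: (ltngtP (deg k + a') (deg j + b'))%N => kj; last first.
  + by rewrite ifT //; lia.
  + by rewrite mulr0 hM' // mulr0 if_same.
  + by rewrite mulr0 ifF //; lia.
- by rewrite hM // !mul0r if_same.
- rewrite mul0r; case: ifP => // /eqP E.
  by rewrite hM' ?mulr0 //; lia.
Qed.

Variables (T : 'M[A]_n) (x : A).
Hypothesis T_homog : forall i j, deg i != (deg j).+1 -> T i j = 0.
Hypothesis T_sq : T *m T = 0.
Hypothesis T_exact : forall z : 'rV_n, (forall j, deg j = 0%N -> z 0 j = 0) ->
  z *m T = 0 -> exists y, y *m T = z.

(** Rows of S are built by increasing degree t. The row [v i] of E - T S uses only rows of S of
    degree t - 1; it is a cycle of degree t + m, hence a boundary when t + m > 0. The remaining case
    m = t = 0 is the last hypothesis. *)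
Lemma null_homotopy m (E : 'M[A]_n) :
  (forall i j, deg j != (deg i + m)%N -> E i j = 0) -> T *m E = E *m T ->
  (m = 0%N -> forall i, deg i = 0%N -> exists y : 'rV_n, y *m T = row i E) ->
  exists S : 'M[A]_n, (forall i j, deg j != (deg i + m.+1)%N -> S i j = 0) /\
    T *m S + S *m T = E.
Proof.
move=> E_homog TE E0.
suff [S [S_homog SE]] : exists S : 'M[A]_n,
    (forall i j, deg j != (deg i + m.+1)%N -> S i j = 0) /\
    forall i, (deg i < (\max_i deg i).+1)%N -> row i (T *m S + S *m T) = row i E.
  exists S; split=> //; apply/row_matrixP => i; apply: SE.
  by rewrite ltnS; exact: leq_bigmax.
elim: (\max_i deg i).+1 => [|t [S [S_homog SE]]].
  by exists 0; split=> // i j _; rewrite mxE.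
have TS_row i (S1 S2 : 'M[A]_n) : (forall k, deg k = (deg i).-1 -> row k S1 =
  row k S2) ->
    row i (T *m S1) = row i (T *m S2).
  move=> S12; rewrite !row_mul !mulmx_sum_row; apply: eq_bigr => k _;
    rewrite !mxE.
  have [ik|ik] := eqVneq (deg i) (deg k).+1; first by rewrite S12 // ik.
  by rewrite T_homog // !scale0r.
have T_deg0 i : deg i = 0%N -> row i T = 0.
  by move=> i0; apply/rowP => j; rewrite !mxE T_homog // i0.
pose v i := row i (E - T *m S).
have v_homog i j : deg j != (deg i + m)%N -> v i 0 j = 0.
  move=> ij; rewrite !mxE E_homog // sub0r big1 ?oppr0 // => k _.
  have [ik|ik] := eqVneq (deg i) (deg k).+1; last by rewrite T_homog ?mul0r.
  by rewrite S_homog ?mulr0 //; lia.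
have yex i : deg i = t -> exists y, y *m T = v i.
  move=> it; have [/andP[/eqP m0 /eqP t0]|mt] := boolP ((m == 0%N) && (t == 0%N)).
    have [|y yE] := E0 m0 i; first by rewrite it.
    exists y; rewrite yE /v; apply/rowP => j; rewrite !mxE.
    rewrite big1 ?subr0 // => k _.
    by rewrite T_homog ?mul0r // it t0.
  apply: T_exact => [j j0|]; first by apply: v_homog; rewrite j0 it; lia.
  rewrite /v -row_mul mulmxBl -TE -mulmxA raddfB /=.
  case: (posnP t) => [t0|t_gt0].
    by rewrite !row_mul T_deg0 ?it // !mul0mx subrr.
  rewrite (TS_row i (S *m T) (E - T *m S)).
    by rewrite mulmxBr mulmxA T_sq mul0mx subr0 subrr.
  move=> k kt; rewrite raddfB /= -SE; last by rewrite kt it; lia.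
  by rewrite raddfD /= addrAC subrr add0r.
pose y i : 'rV[A]_n := if deg i =P t is ReflectT h then sval (cid (yex i h))
  else 0.
have yE i : deg i = t -> y i *m T = v i.
  by rewrite /y; case: eqP => // h _; case: cid.
(* Only the component of [y i] in degree t + m + 1 is kept; as T is homogeneous, its image is still
   [v i]. *)
pose S' := \matrix_(i, j) if deg i == t then
  (if deg j == (deg i + m.+1)%N then y i 0 j else 0) else S i j.
have S'_row i : deg i != t -> row i S' = row i S.
  by move=> it; apply/rowP => j; rewrite !mxE (negbTE it).
have TS' i : (deg i <= t)%N -> row i (T *m S') = row i (T *m S).
  move=> it; case: (posnP (deg i)) => [i0|i0].
    by rewrite !row_mul T_deg0 // !mul0mx.
  by apply: TS_row => k ki; apply: S'_row; lia.
exists S'; split=> [i j ij|i it].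
  by rewrite mxE; case: ifP => _; [rewrite (negbTE ij) | exact: S_homog].
rewrite raddfD /= TS' //; move: it; rewrite ltnS leq_eqVlt => /orP[/eqP it|it].
  suff -> : row i (S' *m T) = v i by rewrite /v raddfB /= addrC subrK.
  apply/rowP => j; rewrite -(yE i it) row_mul !mxE.
  have [ij|ij] := eqVneq (deg j) (deg i + m)%N.
    apply: eq_bigr => k _; rewrite !mxE it eqxx.
    have [_|kj] //= := eqVneq (deg k) (t + m.+1)%N.
    by rewrite T_homog ?mulr0 //; lia.
  have := v_homog i j ij; rewrite -(yE i it) mxE => ->.
  rewrite big1 // => k _; rewrite !mxE it eqxx.
  have [kj|kj] := eqVneq (deg k) (t + m.+1)%N; last by rewrite mul0r.
  by rewrite T_homog ?mulr0 //; lia.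
by rewrite -SE // raddfD /= [in LHS](row_mul _ S') S'_row ?ltn_eqF // -row_mul.
Qed.

Hypothesis x_null : forall i, deg i = 0%N ->
  exists y : 'rV_n, y *m T = x *: delta_mx 0 i.

(* A system of higher homotopies for multiplication by x, summed into a single
   matrix B whose component of degree -1 is T. *)
Lemma higher_homotopies : exists B : 'M[A]_n,
  [/\ deg_ge 0 1 B, odd_degree B, deg_part 0 1 B = T & B *m B = x%:M].
Proof.
have T_part a b : (a.+1 = b)%N -> deg_part a b T = T.
  move=> ab; apply/matrixP => i j; rewrite mxE; case: ifP => // /negbT ij.
  by rewrite T_homog //; lia.
have odd_sq B : odd_degree B -> forall i j, odd (deg i) != odd (deg j) ->
    (x%:M - B *m B) i j = 0.
  move=> Bodd i j ij; rewrite !mxE big1 => [|k _].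
    have [ij0|_] := eqVneq i j; first by rewrite ij0 eqxx in ij.
    by rewrite subr0.
  have [ik|ik] := eqVneq (odd (deg i)) (odd (deg k));
    first by rewrite Bodd ?mul0r.
  rewrite (Bodd k) ?mulr0 //.
  by move: ij ik; case: odd; case: odd; case: odd.
(* The error [x%:M - B *m B] is pushed to ever higher degree. The last clause is recorded because
   for m = 0 the lowest component of the error has to be exactly [x%:M], to which [x_null]
   applies. *)
have step m : exists B : 'M[A]_n,
    [/\ deg_ge 0 1 B, odd_degree B, deg_part 0 1 B = T,
        deg_ge m.*2 0 (x%:M - B *m B) & (m = 0%N -> B = T)].
  elim: m => [|m [B [B_ge B_odd B_part R_ge B0]]].
    exists T; split=> //; last first.
    - by move=> i j ij; rewrite T_sq subr0 mxE; case: eqP ij => // ->;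
      rewrite ltnn.
    - exact: T_part.
    - move=> i j ij; apply: T_homog; apply/eqP => E.
      by move: ij; rewrite E /=; case: odd.
    - by move=> i j ij; apply: T_homog; lia.
  (* R commutes with B, so its lowest component E commutes with T and is null-homotopic. Adding the
     homotopy S, of degree 2m + 1, to B cancels E; the new error has only even degrees, hence
     degrees at least 2m + 2. *)
  pose R := x%:M - B *m B; pose E := deg_part m.*2 0 R.
  have BR : B *m R = R *m B.
    by rewrite mulmxBr mulmxBl mulmxA scalar_mxC.
  have [|||S [S_homog SE]] := @null_homotopy m.*2 E.
  - by move=> i j ij; rewrite mxE; case: ifP => // /eqP; lia.
  - by rewrite -B_part -(deg_part_mul B_ge R_ge) BR addnC [(1 + 0)%N]addnC
    deg_part_mul.
  - move=> m0 i i0; have [y yE] := x_null i0; exists y; rewrite yE.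
    have {}m0 : m = 0%N by lia.
    have -> : E = x%:M; last by rewrite rowE mul_mx_scalar.
    apply/matrixP => j k; rewrite /E /R B0 // T_sq subr0 m0 !mxE.
    by case: (eqVneq j k) => [->|_]; rewrite ?eqxx ?if_same.
  have S_ge : deg_ge m.*2.+1 0 S by move=> i j ij; apply: S_homog; lia.
  have S_part : deg_part m.*2.+1 0 S = S.
    by apply/matrixP => i j; rewrite mxE; case: ifP => // /negbT ij;
      rewrite S_homog //; lia.
  have S_odd : odd_degree S.
    move=> i j ij; apply: S_homog; apply/eqP => E'; move: ij.
    by rewrite E' oddD /= odd_double; case: odd.
  have B'_odd : odd_degree (B + S).
    by move=> i j ij; rewrite mxE B_odd // S_odd // addr0.
  exists (B + S); split=> //.
  - by move=> i j ij; rewrite mxE B_ge // S_ge ?addr0 //; lia.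
  - rewrite -[RHS]B_part; apply/matrixP => i j; rewrite !mxE;
    case: ifP => // /eqP ij.
    by rewrite S_ge ?addr0 //; lia.
  - have RE : x%:M - (B + S) *m (B + S) = R - (B *m S + S *m B + S *m S).
      by rewrite mulmxDl !mulmxDr /R -!addrA -!opprD -?addrA.
    move=> i j ij; have [par|par] := eqVneq (odd (deg i)) (odd (deg j));
      last first.
      exact: odd_sq.
    have SB_ge : deg_ge (m.*2.+1 + 0) (0 + 1) (S *m B) by exact: deg_ge_mul.
    have BS_ge : deg_ge (0 + m.*2.+1) (1 + 0) (B *m S) by exact: deg_ge_mul.
    have SS_ge : deg_ge (m.*2.+1 + m.*2.+1) (0 + 0) (S *m S) by exact: deg_ge_mul.
    have SS0 : (S *m S) i j = 0 by apply: SS_ge; lia.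
    rewrite RE mxE [X in _ + X]mxE [X in _ - X]mxE SS0 addr0.
    have [ij1|ij1] := eqVneq (deg j) (deg i + m.*2)%N; last first.
      have {}ij : (deg j < deg i + m.*2)%N.
        have : deg j != (deg i + m.*2.+1)%N.
          by apply/eqP => E'; move: par; rewrite E' oddD /= odd_double; case: odd.
        lia.
      have -> : R i j = 0 by apply: R_ge; lia.
      by rewrite mxE BS_ge ?SB_ge ?addr0 ?subr0 //; lia.
    have -> : R i j = E i j by rewrite [RHS]mxE ifT //; lia.
    have -> : E = deg_part (0 + m.*2.+1) (1 + 0) (B *m S) +
        deg_part (m.*2.+1 + 0) (0 + 1) (S *m B).
      by rewrite !deg_part_mul // S_part B_part SE.
    rewrite !mxE ifT; last by lia.
    by rewrite ifT ?subrr //; lia.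
(* Beyond the largest degree there is no room for an error. *)
have [B [B_ge B_odd B_part R_ge _]] := step (\max_i deg i).+1.
exists B; split=> //; apply/eqP; rewrite eq_sym -subr_eq0;
  apply/eqP/matrixP => i j.
rewrite [RHS]mxE R_ge //; have := leq_bigmax (F := deg) j; lia.
Qed.
End Homotopies.

(** * Shamash's resolution *)

Lemma lin_val_mul (S : pzRingType) (N : lmodType S) m n (e : 'I_n -> N)
    (u : 'rV[S]_m) (M : 'M[S]_(m, n)) :
  lin_val e (u *m M) = lin_val (fun i => lin_val e (row i M)) u.
Proof.
rewrite mulmx_sum_row linear_sum; apply: eq_bigr => i _; exact: linearZ.
Qed.

Section CoordinateInclusion.
Variables (R : pzRingType) (n : nat).
Implicit Types D : {set 'I_n}.

Definition incl_mx D : 'M[R]_(#|D|, n) := \matrix_(a, j) (enum_val a == j)%:R.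

Definition supported D (w : 'rV[R]_n) := forall j, j \notin D -> w 0 j = 0.

Lemma row_incl_mx D a : row a (incl_mx D) = delta_mx 0 (enum_val a).
Proof. by apply/rowP => j; rewrite !mxE eqxx eq_sym. Qed.

Lemma mul_incl_tr m D (w : 'M[R]_(m, n)) i a :
  (w *m (incl_mx D)^T) i a = w i (enum_val a).
Proof.
rewrite mxE (bigD1 (enum_val a)) //= !mxE eqxx mulr1 big1 ?addr0 // => j ja.
by rewrite !mxE eq_sym (negbTE ja) mulr0.
Qed.

Lemma mul_incl_val D (v : 'rV[R]_#|D|) a : (v *m incl_mx D) 0 (enum_val a) = v
  0 a.
Proof.
rewrite mxE (bigD1 a) //= !mxE eqxx mulr1 big1 ?addr0 // => b ba.
by rewrite !mxE (inj_eq enum_val_inj) (negbTE ba) mulr0.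
Qed.

Lemma supported_incl D (v : 'rV[R]_#|D|) : supported D (v *m incl_mx D).
Proof.
move=> j jD; rewrite mxE big1 // => a _; rewrite mxE.
by case: eqP => [aj|_]; rewrite ?mulr0 //; rewrite -aj enum_valP in jD.
Qed.

Lemma incl_mxK D (v : 'rV[R]_#|D|) : v *m incl_mx D *m (incl_mx D)^T = v.
Proof. by apply/rowP => a; rewrite mul_incl_tr mul_incl_val. Qed.

Lemma incl_trE D (w : 'rV[R]_n) j :
  (w *m (incl_mx D)^T *m incl_mx D) 0 j = if j \in D then w 0 j else 0.
Proof.
case: ifP => [jD|/negbT jD]; last exact: supported_incl.
by rewrite -(enum_rankK_in jD jD) mul_incl_val mul_incl_tr.
Qed.

Lemma incl_trK D (w : 'rV[R]_n) : supported D w ->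
  w *m (incl_mx D)^T *m incl_mx D = w.
Proof.
by move=> wD; apply/rowP => j; rewrite incl_trE; case: ifP => // /negbT/wD ->.
Qed.

Lemma eq_incl_tr D (v w : 'rV[R]_n) : (forall j, j \in D -> v 0 j = w 0 j) ->
  v *m (incl_mx D)^T = w *m (incl_mx D)^T.
Proof. by move=> vw; apply/rowP => a; rewrite !mul_incl_tr vw // enum_valP. Qed.

End CoordinateInclusion.

Lemma map_incl_mx (R R' : pzRingType) (phi : {rmorphism R -> R'}) n
    (D : {set 'I_n}) : map_mx phi (incl_mx R D) = incl_mx R' D.
Proof. by apply/matrixP => a j; rewrite !mxE rmorph_nat. Qed.

Section Shamash.
Variables (n : nat) (deg : 'I_n -> nat).

(* Basis of the m-th term: the total degree m part of divided powers on one
   generator of degree 2, tensored with the graded free module. *)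
Definition shamash_basis m : {set 'I_n} :=
  [set j | (deg j <= m)%N && (odd (deg j) == odd m)].

(** In total degree m the divided power attached to j is forced to be the one of index (m - deg
    j)/2, so the differential is a block of B; the components cut off would have a negative
    index. *)
Definition shamash_diff (R : pzRingType) (B : 'M[R]_n) m :
    'M[R]_(#|shamash_basis m.+1|, #|shamash_basis m|) :=
  incl_mx R (shamash_basis m.+1) *m B *m (incl_mx R (shamash_basis m))^T.

Lemma map_shamash_diff (R R' : pzRingType) (phi : {rmorphism R -> R'}) B m :
  map_mx phi (shamash_diff B m) = shamash_diff (map_mx phi B) m.
Proof. by rewrite /shamash_diff !map_mxM -matrix.map_trmx !map_incl_mx. Qed.

Lemma odd_degree_mul (A : comPzRingType) (B : 'M[A]_n) (Z : 'rV[A]_n) b :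
  odd_degree deg B -> (forall j, odd (deg j) != b -> Z 0 j = 0) ->
  forall j, odd (deg j) = b -> (Z *m B) 0 j = 0.
Proof.
move=> B_odd Zb j jb; rewrite mxE big1 // => k _.
have [kb|kb] := eqVneq (odd (deg k)) b; last by rewrite Zb ?mul0r.
by rewrite B_odd ?mulr0 // kb.
Qed.

Section Resolution.
Variables (A : comPzRingType) (T B : 'M[A]_n) (x : A).
Hypothesis x_reg : GRing.lreg x.
Hypothesis T_homog : forall i j, deg i != (deg j).+1 -> T i j = 0.
Hypothesis T_exact : forall z : 'rV_n, (forall j, deg j = 0%N -> z 0 j = 0) ->
  z *m T = 0 -> exists y, y *m T = z.
Hypothesis B_ge : deg_ge deg 0 1 B.
Hypothesis B_odd : odd_degree deg B.
Hypothesis B_part : deg_part deg 0 1 B = T.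
Hypothesis B_sq : B *m B = x%:M.

Variables (N : lmodType (quot_ring x)) (e : 'I_#|shamash_basis 0| -> N).
Local Notation pi := (quot_ring_pi x).
Local Notation incl m := (incl_mx A (shamash_basis m)).
Hypothesis e_gen : forall y, exists v : 'rV[A]_ _, lin_val e (map_mx pi v) = y.
Hypothesis e_rel : forall v : 'rV[A]_ _,
  lin_val e (map_mx pi v) = 0 <-> exists y, y *m (T *m (incl 0)^T) = v.

Let TE i j : deg i = (deg j).+1 -> T i j = B i j.
Proof. by move=> ij; rewrite -B_part mxE ifT //; lia. Qed.

Let B0 i j : ((deg j).+1 < deg i)%N -> B i j = 0.
Proof. by move=> ij; apply: B_ge; lia. Qed.

Let part (y : 'rV[A]_n) m : 'rV[A]_n := \row_j if deg j == m then y 0 j else 0.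

(** Here w is a first guess for a preimage of Z, with error V = Z - w B. As x V = t B, where t
    starts in degree m + 2 and B lowers degrees by at most 1, regularity of x makes V start in
    degree m + 1. There V B = t makes its lowest part a cycle of T, hence the image of some y, and w
    plus the part of y in degree m + 2 is the preimage. *)
Let shamash_cycle m (Z : 'rV[A]_n) w0 : supported (shamash_basis m.+1) Z ->
  Z *m B *m (incl_mx A (shamash_basis m))^T = x *: w0 ->
  exists2 Y : 'rV[A]_n, supported (shamash_basis m.+2) Y &
    forall j, j \in shamash_basis m.+1 -> (Y *m B) 0 j = Z 0 j.
Proof.
move=> Z_supp ZB; pose w := w0 *m incl_mx A (shamash_basis m).
have w_supp : supported (shamash_basis m) w by exact: supported_incl.
pose t := Z *m B - x *: w; pose V := Z - w *m B.
have Z_par j : odd (deg j) != odd m.+1 -> Z 0 j = 0.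
  by move=> jm; apply: Z_supp; rewrite inE (negbTE jm) andbF.
have w_par j : odd (deg j) != odd m -> w 0 j = 0.
  by move=> jm; apply: w_supp; rewrite inE (negbTE jm) andbF.
have t0 j : (deg j <= m.+1)%N -> t 0 j = 0.
  move=> jm; rewrite mxE [X in _ + X]mxE [X in _ - X]mxE.
  have [jm'|jm'] := eqVneq (odd (deg j)) (odd m).
    have jS : j \in shamash_basis m.
      rewrite inE jm' eqxx andbT -ltnS ltn_neqAle jm andbT.
      by apply/eqP => E; move: jm'; rewrite E /=; case: odd.
    have <- : (x *: w) 0 j = (Z *m B) 0 j; last by rewrite mxE subrr.
    rewrite -[RHS](_ : (Z *m B *m (incl_mx A (shamash_basis m))^T *m
      incl_mx A (shamash_basis m)) 0 j = _); last by rewrite incl_trE jS.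
    by rewrite ZB -scalemxAl.
  rewrite w_par // mulr0 subr0; apply: (odd_degree_mul B_odd Z_par).
  by move: jm' => /=; case: odd; case: odd.
have xV : x *: V = t *m B.
  by rewrite mulmxBl -mulmxA B_sq mul_mx_scalar scalerBr scalemxAl.
have VB : V *m B = t by rewrite mulmxBl -mulmxA B_sq mul_mx_scalar.
have V0 j : (deg j <= m)%N -> V 0 j = 0.
  move=> jm; apply: x_reg; rewrite mulr0.
  have -> : x * V 0 j = (x *: V) 0 j by rewrite [RHS]mxE.
  rewrite xV mxE big1 // => k _; have [km|km] := leqP (deg k) m.+1.
    by rewrite t0 ?mul0r.
  by rewrite B0 ?mulr0 //; lia.
have [||y yE] := T_exact (z := part V m.+1).
- by move=> j j0; rewrite mxE j0.
- apply/rowP => j; rewrite !mxE.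
  have [jm|jm] := eqVneq (deg j) m; last first.
    rewrite big1 // => k _; rewrite mxE; case: ifP => [/eqP km|_];
      last by rewrite mul0r.
    by rewrite T_homog ?mulr0 //; lia.
  rewrite -[RHS](t0 j); last by lia.
  rewrite -VB mxE; apply: eq_bigr => k _; rewrite mxE.
  case: (ltngtP (deg k) m.+1) => km.
  + by rewrite V0 ?mul0r //; lia.
  + by rewrite mul0r B0 ?mulr0 //; lia.
  + by rewrite TE //; lia.
exists (w + part y m.+2).
  move=> j jm; rewrite mxE w_supp ?add0r.
    rewrite mxE; case: eqP => // E; move: jm; rewrite inE E leqnn /= eqxx //.
  by apply: contra jm; rewrite !inE /= negbK => /andP[jm ->]; rewrite andbT; lia.
move=> j; rewrite inE => /andP[jm par]; rewrite mulmxDl mxE.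
have ->: Z 0 j = (w *m B) 0 j + V 0 j by rewrite [V 0 j]mxE [X in _ + (_ +
  X)]mxE addrC subrK.
congr (_ + _); have [jm'|jm'] := leqP (deg j) m.
  rewrite V0 // mxE big1 // => k _; rewrite mxE; case: ifP => [/eqP km|_].
    by rewrite B0 ?mulr0 //; lia.
  by rewrite mul0r.
have jm1 : deg j = m.+1 by lia.
have -> : V 0 j = part V m.+1 0 j by rewrite [RHS]mxE jm1 eqxx.
rewrite -yE !mxE; apply: eq_bigr => k _; rewrite mxE;
  case: ifP => [/eqP km|/eqP km].
  by rewrite TE //; lia.
by rewrite T_homog ?mul0r ?mulr0 //; apply/eqP; lia.
Qed.

Let shamash_sq m : map_mx pi (shamash_diff B m.+1) *m map_mx pi (shamash_diff B
  m) = 0.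
Proof.
rewrite -map_mxM; apply/map_mx_quot_ring.
(* The projection inserted between the two factors B loses nothing: an omitted index either has the
   wrong parity or has degree above m + 1, from which B does not reach degree m or less. *)
exists (incl_mx A (shamash_basis m.+2) *m (incl_mx A (shamash_basis m))^T).
apply/row_matrixP => a; rewrite row_mul /shamash_diff !row_mul.
set Z := row a _; have Z_par j : odd (deg j) != odd m.+2 -> Z 0 j = 0.
  move=> jm; rewrite !mxE; case: eqP => // aj; move: (enum_valP a).
  by rewrite inE aj (negbTE jm) andbF.
rewrite linearZ /= row_mul -/Z scalemxAl !mulmxA; apply: eq_incl_tr => j.
rewrite inE => /andP[jm par].
rewrite -mul_mx_scalar -B_sq mulmxA !mxE; apply: eq_bigr => k _.
rewrite incl_trE; case: ifP => // /negbT kS; rewrite mul0r.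
have [km|km] := leqP (deg k) m.+1; last by rewrite B0 ?mulr0 //; lia.
rewrite (odd_degree_mul B_odd Z_par) ?mul0r //.
move: kS; rewrite inE km /= negbK.
by case: odd; case: odd.
Qed.

Lemma shamash_resolution :
  matrix_resolution (fun m => map_mx pi (shamash_diff B m)) e.
Proof.
have S0 j : (j \in shamash_basis 0) = (deg j == 0%N).
  by rewrite inE leqn0; case: eqP => // ->.
have S1 j : (j \in shamash_basis 1) = (deg j == 1%N).
  by rewrite inE; case: (deg j) => [|[]].
have BT (Y : 'rV[A]_n) : Y *m (incl 1)^T *m shamash_diff B 0 = Y *m (T *m (incl
  0)^T).
  rewrite /shamash_diff !mulmxA; apply: eq_incl_tr => j; rewrite S0 => /eqP j0.
  rewrite !mxE; apply: eq_bigr => k _; rewrite incl_trE S1.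
  by case: eqP => k1; [rewrite TE ?k1 ?j0 | rewrite T_homog ?mulr0 ?mul0r //
    j0; exact/eqP].
split=> [y|v|m z].
- by have [v <-] := e_gen y; exists (map_mx pi v).
- rewrite -{1}[v]mx_reprK e_rel; split=> [[y yE]|[y yE]].
    exists (map_mx pi (y *m (incl 1)^T)).
    by rewrite -map_mxM BT yE mx_reprK.
  have [w wE] : exists w, mx_repr v - mx_repr y *m shamash_diff B 0 = x *: w.
    by apply/map_mx_quot_ring; rewrite map_mxB map_mxM !mx_reprK yE subrr.
  have [y' y'E] : exists y', y' *m (T *m (incl 0)^T) = x *: w.
    apply/e_rel; rewrite (_ : map_mx pi (x *: w) = 0) ?linear0 //.
    by apply/map_mx_quot_ring; exists w.
  exists (mx_repr y *m incl 1 + y'); rewrite mulmxDl y'E -BT incl_mxK -wE.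
  by rewrite addrC subrK.
- split=> [|[y <-]]; last by rewrite -mulmxA shamash_sq mulmx0.
  rewrite -[z]mx_reprK -map_mxM => /map_mx_quot_ring[w0 w0E].
  pose Z := mx_repr z *m incl_mx A (shamash_basis m.+1).
  have [|Y Y_supp YE] := @shamash_cycle m Z w0 (@supported_incl _ _ _ _).
    by rewrite -w0E /shamash_diff !mulmxA.
  exists (map_mx pi (Y *m (incl_mx A (shamash_basis m.+2))^T)).
  rewrite -map_mxM; congr map_mx; rewrite /shamash_diff !mulmxA incl_trK //.
  by rewrite (eq_incl_tr YE) incl_mxK.
Qed.

End Resolution.
End Shamash.

(* From degree D on, the basis of the m-th term consists of all elements of the
   parity of m, so that the complex becomes 2-periodic. *)
Lemma shamash_homology (R : comPzRingType) n (deg : 'I_n -> nat) (B : 'M[R]_n)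
  D m h :
  (forall i, (deg i <= D)%N) -> odd_degree deg B -> (D <= m.+1)%N ->
  let ann m := forall z : 'rV_#|shamash_basis deg m.+1|,
    z *m shamash_diff deg B m = 0 -> exists y, y *m shamash_diff deg B m.+1 = h
      *: z in
  (ann m /\ ann m.+1) <->
  (forall w : 'rV_n, w *m B = 0 -> exists y, y *m B = h *: w).
Proof.
move=> degD B_odd Dm ann.
(* Degrees are bounded only by m + 1, but an element of degree m + 1 has the wrong parity for index
   m, so the basis is already full there. This is why Tor in degree D itself is covered. *)
have SE i j : (m <= i)%N -> (j \in shamash_basis deg i) = (odd (deg j) == odd i).
  move=> mi; rewrite inE; case: eqP => [E|]; rewrite ?andbT ?andbF //.
  have := degD j; rewrite leq_eqVlt => /orP[/eqP jD|]; last by lia.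
  have [//|ji] := leqP (deg j) i; have ji1 : deg j = i.+1 by lia.
  by move: E; rewrite ji1 /=; case: odd.
have suppP i (v : 'rV[R]_n) : (m <= i)%N -> supported (shamash_basis deg i) v <->
    forall j, odd (deg j) != odd i -> v 0 j = 0.
  by move=> mi; split=> v0 j; [rewrite -SE // | rewrite SE //]; exact: v0.
have suppM i (v : 'rV[R]_n) : (m <= i)%N -> supported (shamash_basis deg i.+1)
  v ->
    supported (shamash_basis deg i) (v *m B).
  move=> mi /suppP v0; apply/suppP => // j ji.
  apply: (odd_degree_mul B_odd (v0 _)); first by lia.
  by move: ji => /=; case: odd; case: odd.
split=> [[hm hm1] w wB|hB]; last first.
  suff annB i : (m <= i)%N -> ann i by split; apply: annB.
  move=> mi z; rewrite /shamash_diff !mulmxA => zB.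
  pose w := z *m incl_mx R (shamash_basis deg i.+1).
  have wB : w *m B = 0.
    rewrite -(incl_trK (D := shamash_basis deg i) (w := w *m B)) ?zB ?mul0mx //.
    by apply: suppM => //; exact: supported_incl.
  have [y yE] := hB w wB.
  exists (y *m (incl_mx R (shamash_basis deg i.+2))^T).
  rewrite !mulmxA -[h *: z]incl_mxK -scalemxAl -/w -yE; apply: eq_incl_tr => j.
  rewrite SE ?leqW // => /eqP ji; rewrite !mxE; apply: eq_bigr => k _.
  rewrite incl_trE SE; last by do 2 apply: leqW.
  case: eqP => // ki; rewrite mul0r B_odd ?mulr0 //.
  by move: ki; rewrite ji /=; case: odd; case: odd.
have half i : (m <= i)%N -> ann i -> exists y, y *m B =
    h *: (w *m (incl_mx R (shamash_basis deg i.+1))^T *m incl_mx R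
      (shamash_basis deg i.+1)).
  move=> mi /(_ (w *m (incl_mx R (shamash_basis deg i.+1))^T)).
  set w' := w *m _ *m _; case=> [|y yE].
    rewrite /shamash_diff !mulmxA -/w' -[RHS](mul0mx _ (incl_mx R
      (shamash_basis deg i))^T) -wB.
    apply: eq_incl_tr => j; rewrite SE // => /eqP ji; rewrite !mxE;
      apply: eq_bigr => k _.
    rewrite incl_trE SE ?leqW //; case: eqP => // ki;
      rewrite mul0r B_odd ?mulr0 //.
    by move: ki; rewrite ji /=; case: odd; case: odd.
  exists (y *m incl_mx R (shamash_basis deg i.+2)).
  rewrite /w' scalemxAl -yE /shamash_diff !mulmxA incl_trK //.
  by apply: suppM; [exact: leqW | exact: supported_incl].
have [y0 y0E] := half m (leqnn m) hm; have [y1 y1E] := half m.+1 (leqnSn m) hm1.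
exists (y0 + y1); rewrite mulmxDl y0E y1E -scalerDr; congr (_ *: _).
apply/rowP => j; rewrite mxE !incl_trE !SE ?leqW //=.
by case: odd; case: odd; rewrite ?addr0 ?add0r.
Qed.

(** * Polynomial matrices and their values at a point *)

Section Substitution.
Variables (R : comNzRingType) (c : nat).

Lemma mpoly_rmorph_ext (S : comNzRingType) (F G : {rmorphism {mpoly R[c]} -> S}) :
  (forall a, F a%:MP = G a%:MP) -> (forall i, F 'X_i = G 'X_i) -> F =1 G.
Proof.
move=> FG_C FG_X p; rewrite (mpolyE p) !rmorph_sum; apply: eq_bigr => m _.
rewrite -mul_mpolyC !rmorphM FG_C mpolyXE_id !rmorph_prod; congr (_ * _).
by apply: eq_bigr => i _; rewrite !rmorphXn FG_X.
Qed.

Definition subst (v : 'I_c -> {mpoly R[c]}) (p : {mpoly R[c]}) : {mpoly R[c]} :=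
  p \mPo [tuple v i | i < c].

HB.instance Definition _ v := GRing.RMorphism.copy (subst v) (comp_mpoly [tuple
  v i | i < c]).

Lemma substC v a : subst v a%:MP = a%:MP.
Proof. exact: comp_mpolyC. Qed.

Lemma substX v i : subst v 'X_i = v i.
Proof. by rewrite /subst comp_mpolyXU -tnth_nth tnth_mktuple. Qed.

(** If q p = 0, the coefficient of q p at m is that of p at m times the constant term of q, plus
    terms with coefficients of p in lower degree, which vanish by induction. *)
Lemma lreg_mcoeff0 (q : {mpoly R[c]}) : GRing.lreg q@_0%MM -> GRing.lreg q.
Proof.
move=> q0; apply: mulrI0_lreg => p qp; apply/mpolyP => m; rewrite mcoeff0.
have [N] := ubnP (mdeg m); elim: N m => // N IHN m mN.
apply: q0; rewrite mulr0 mulrC.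
have <- : (p * q)@_m = p@_m * q@_0%MM; last by rewrite mulrC qp mcoeff0.
have mB : (mdeg m < (mdeg m).+1)%N by [].
have zB : (mdeg (0%MM : 'X_{1..c}) < (mdeg m).+1)%N by rewrite mdeg0.
rewrite mcoeffM (bigD1 (BMultinom mB, BMultinom zB)) /=; last by rewrite addm0.
rewrite big1 ?addr0 // => -[k1 k2] /= /andP[/eqP mk k12].
have [k20|k20] := eqVneq (bmnm k2) 0%MM.
  have mk1 : m = bmnm k1 by move: (mk); rewrite k20 addm0.
  by case/eqP: k12; congr (_, _); apply: val_inj.
have := congr1 (@mdeg c) mk; rewrite mdegD => mE.
by rewrite IHN ?mul0r //; rewrite -mdeg_eq0 in k20; lia.
Qed.

(** Translation by a turns the value at a into the constant term. *)
Lemma lreg_meval (q : {mpoly R[c]}) (a : 'I_c -> R) :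
  GRing.lreg q.@[a] -> GRing.lreg q.
Proof.
move=> qa; pose t := subst (fun i => 'X_i + (a i)%:MP).
pose t' := subst (fun i => 'X_i - (a i)%:MP).
have tK : cancel t t'.
  apply: (@mpoly_rmorph_ext _ (t' \o t) idfun) => [b|i] /=;
    first by rewrite /t /t' !substC.
  by rewrite /t substX rmorphD /= /t' substC substX subrK.
have t0 : (t q)@_0%MM = q.@[a].
  apply: (@mpoly_rmorph_ext _ (mcoeff 0%MM \o t) (meval a)) => [b|i] /=.
    by rewrite /t substC mcoeffC eqxx mulr1 mevalC.
  rewrite /t substX mcoeffD mcoeffC eqxx mulr1 mevalXU mcoeffX.
  by rewrite mnm1_eq0 add0r.
have tq : GRing.lreg (t q) by apply: lreg_mcoeff0; rewrite t0.
apply: mulrI0_lreg => p qp; apply: (can_inj tK); apply: tq.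
transitivity (t (q * p)); first by rewrite /t rmorphM.
by rewrite qp /t !rmorph0 mulr0.
Qed.

End Substitution.

(** Flatness of P[s] over P, one monomial at a time. The predicate D accommodates exactness that is
    known in positive degrees only. *)
Lemma mpoly_exact (P : comNzRingType) c m n l (C : 'M[P]_(m, n)) (K : 'M[P]_(l,
  m))
    (D : pred 'I_m) :
  (forall z : 'rV_m, (forall j, D j -> z 0 j = 0) -> z *m C = 0 ->
     exists y, y *m K = z) ->
  forall z : 'rV_m, (forall j, D j -> z 0 j = 0) ->
    z *m map_mx (@mpolyC c P) C = 0 -> exists y, y *m map_mx (@mpolyC c P) K = z.
Proof.
move=> CK z z0 zC.
pose zc mm : 'rV[P]_m := map_mx (mcoeff mm) z.
have /choice[y yE] : forall mm, exists y, y *m K = zc mm.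
  move=> mm; apply: CK => [j Dj|]; first by rewrite mxE z0 // mcoeff0.
  apply/rowP => j; move/rowP: zC => /(_ j)/(congr1 (mcoeff mm)).
  rewrite !mxE mcoeff0 raddf_sum => zC0; apply: etrans zC0; apply: eq_bigr => i _.
  by rewrite /= !mxE mulrC -mcoeffCM mulrC.
pose k := (\max_j msize (z 0%R j))%N.
exists (\sum_(mm : 'X_{1..c < k}) 'X_[mm] *: map_mx (@mpolyC c P) (y mm)).
rewrite mulmx_suml; apply/rowP => j; rewrite summxE.
rewrite [RHS](mpolywE (k := k)); last exact: leq_bigmax.
apply: eq_bigr => mm _; rewrite -scalemxAl -map_mxM yE !mxE mulrC.
by rewrite mul_mpolyC.
Qed.

(** * Exactness of a square-zero polynomial matrix at a point *)

Section EvaluationExact.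
Variables (k : fieldType) (c n : nat) (B : 'M[{mpoly k[c]}]_n).
Hypothesis B_sq : B *m B = 0.
Variable (a : 'I_c -> k).

Let sub j := subst (fun i : 'I_c => if (i < j)%N then (a i)%:MP else 'X_i).

Let subD j p q : sub j (p + q) = sub j p + sub j q. Proof. exact: rmorphD. Qed.
Let subB j p q : sub j (p - q) = sub j p - sub j q. Proof. exact: rmorphB. Qed.
Let subM j p q : sub j (p * q) = sub j p * sub j q. Proof. exact: rmorphM. Qed.
Let sub0 j : sub j 0 = 0. Proof. exact: rmorph0. Qed.
Let sub1 j : sub j 1 = 1. Proof. exact: rmorph1. Qed.

(** The polynomials with this divisibility are closed under sums and products, so constants and
    variables suffice. Keeping the quotient in the image of [sub j] lets it be used as data at stage
    j. *)
Let sub_step (j : 'I_c) g : exists q, sub j g - sub j.+1 g = ('X_j - (a j)%:MP)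
  * sub j q.
Proof.
have [x [sx xE]] : exists x, sub j x = x /\ x = 'X_j - (a j)%:MP.
  by eexists; split; last reflexivity; rewrite subB /sub substC substX ltnn.
rewrite -xE.
pose ok g := exists q, sub j g - sub j.+1 g = x * sub j q.
have okM g1 g2 : ok g1 -> ok g2 -> ok (g1 * g2).
  move=> [q1 E1] [q2 E2]; exists (q1 * g2 + (g1 - x * q1) * q2).
  have E : sub j.+1 g1 = sub j g1 - x * sub j q1 by rewrite -E1 opprB addrC subrK.
  rewrite 2!subM subD subM [sub j (_ * q2)]subM subB subM sx.
  rewrite -E mulrDr mulrA -E1 mulrCA -E2.
  move: (sub j g1) (sub j g2) (sub j.+1 g1) (sub j.+1 g2) => p1 p2 p3 p4.
  by rewrite mulrBl mulrBr addrA subrK.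
have ok_sum (I : Type) (s : seq I) (F : I -> {mpoly k[c]}) :
    (forall i, ok (F i)) -> ok (\sum_(i <- s) F i).
  move=> okF; elim/big_rec: _ => [|i p _ [q E]].
    by exists 0; rewrite !sub0 subrr mulr0.
  have [q' E'] := okF i; exists (q' + q).
  by rewrite !subD mulrDr -E -E' opprD addrACA.
have ok_prod (I : Type) (s : seq I) (F : I -> {mpoly k[c]}) :
    (forall i, ok (F i)) -> ok (\prod_(i <- s) F i).
  move=> okF; elim/big_rec: _ => [|i p _ op]; last exact: okM.
  by exists 0; rewrite !sub1 sub0 subrr mulr0.
rewrite -/(ok g) (mpolyE g); apply: ok_sum => m; rewrite -mul_mpolyC mpolyXE_id.
apply: (okM); first by exists 0; rewrite sub0 /sub !substC subrr mulr0.
apply: ok_prod => i; elim: (m i) => [|e IHe].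
  by exists 0; rewrite expr0 !sub1 sub0 subrr mulr0.
rewrite exprS; apply: (okM) IHe.
have sX l : sub l 'X_i = if (i < l)%N then (a i)%:MP else 'X_i by exact: substX.
rewrite /ok !sX ltnS; case: ltngtP => ij /=.
- by exists 0; rewrite sub0 subrr mulr0.
- by exists 0; rewrite sub0 subrr mulr0.
- by exists 1; rewrite sub1 mulr1 xE (val_inj ij).
Qed.

(* Specialise the variables one at a time. If h kills the homology of B after j
   substitutions then h ^+ 2 kills it after j + 1, by the long exact sequence of
   multiplication by X_j - a_j. *)
Lemma exact_eval h : h.@[a] != 0 ->
  (forall z : 'rV_n, z *m B = 0 -> exists y, y *m B = h *: z) ->
  forall w : 'rV_n, w *m map_mx (meval a) B = 0 ->
    exists y, y *m map_mx (meval a) B = w.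
Proof.
move=> ha hB.
(* Statements about stage j are phrased as vanishing under [sub j], so that the polynomial ring
   never changes. *)
have step j : (j <= c)%N -> exists2 h, h.@[a] != 0 &
    forall z : 'rV_n, map_mx (sub j) (z *m B) = 0 ->
      exists y, map_mx (sub j) (h *: z - y *m B) = 0.
  elim: j => [_|j IHj jc].
    exists h => // z; have sub_0 g : sub 0%N g = g.
      apply: (@mpoly_rmorph_ext _ _ _ (sub 0%N) idfun) => [b|i] /=.
        exact: substC.
      exact: substX.
    have -> : map_mx (sub 0%N) (z *m B) = z *m B by apply/rowP => i;
      rewrite mxE sub_0.
    move/hB => [y yE]; exists y; rewrite yE subrr; apply/rowP => i.
    by rewrite !mxE sub_0.
  have [g ga gP] := IHj (ltnW jc).
  have [x [xE sx x0 subSx]] : exists x, [/\ x = 'X_(Ordinal jc) - (a (Ordinal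
    jc))%:MP,
      sub j x = x, x != 0 & sub j.+1 x = 0].
    eexists; split; first reflexivity.
    - by rewrite subB /sub substC substX ltnn.
    - apply/eqP => /(congr1 (mcoeff U_(Ordinal jc))).
      rewrite mcoeffB mcoeffX eqxx mcoeffC mnm1_eq0 mulr0 subr0 mcoeff0.
      by move/eqP; rewrite oner_eq0.
    - by rewrite subB /sub substC substX ltnSn subrr.
  have x_reg : GRing.lreg x by apply/lregP.
  have subS_sub u : sub j.+1 (sub j u) = sub j.+1 u.
    apply: (@mpoly_rmorph_ext _ _ _ (sub j.+1 \o sub j) (sub j.+1)) => [b|i] /=.
      by rewrite /sub !substC.
    rewrite /sub !substX; case: ifP => [ij|_]; last by rewrite substX.
    by rewrite substC ltnW.
  have mapZ l p m q (M : 'M_(m, q)) : map_mx (sub l) (p *: M) = sub l p *: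
    map_mx (sub l) M.
    by apply/matrixP => i i'; rewrite !mxE subM.
  exists (g ^+ 2) => [|z zB]; first by rewrite rmorphXn expf_neq0.
  (* The connecting map: z B = x w at stage j, and w is a cycle because x is regular. With g w = y
     B, the vector g z - x y is a cycle; a second use of g makes g^2 z - g x y a boundary, and x
     becomes 0 at stage j + 1. *)
  have [w wE] : exists w : 'rV_n, map_mx (sub j) (z *m B) = x *: map_mx (sub j) w.
    have /choice[q qE] i : exists q, sub j ((z *m B) 0 i) = x * sub j q.
      have [q qE] := sub_step (Ordinal jc) ((z *m B) 0 i); exists q.
      by rewrite xE -qE; move/rowP: zB => /(_ i); rewrite [LHS]mxE => ->;
        rewrite [X in _ - X]mxE subr0.
    by exists (\row_i q i); apply/rowP => i; rewrite [LHS]mxE qE !mxE.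
  have /gP[y yE] : map_mx (sub j) (w *m B) = 0.
    apply: (scalemx_lreg x_reg); rewrite scaler0 map_mxM scalemxAl -wE -map_mxM.
    by rewrite -mulmxA B_sq mulmx0 map_mx0.
  have [|y' y'E] := gP (g *: z - x *: y).
    rewrite mulmxBl map_mxB -!scalemxAl !mapZ sx wE.
    by rewrite scalerA mulrC -scalerA -scalerBr -mapZ -map_mxB yE scaler0.
  exists y'; move: y'E; rewrite scalerBr !scalerA -expr2 => y'E.
  have : map_mx (sub j.+1) (g ^+ 2 *: z - (g * x) *: y - y' *m B) = 0.
    apply/rowP => i; move/rowP: y'E => /(_ i)/(congr1 (sub j.+1)).
    rewrite [X in sub j.+1 X = _]mxE subS_sub => E.
    by rewrite [LHS]mxE E [X in sub _ X]mxE sub0 mxE.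
  by rewrite !map_mxB !mapZ (subM _ g x) subSx mulr0 scale0r subr0.
have [g ga gP] := step c (leqnn c).
have subc u : sub c u = (u.@[a])%:MP.
  apply: (@mpoly_rmorph_ext _ _ _ (sub c) (@mpolyC c k \o meval a)) => [b|i] /=.
    by rewrite /sub substC mevalC.
  by rewrite /sub substX ltn_ord mevalXU.
move=> w wB.
have ev (u : 'rV_n) : map_mx (meval a) (map_mx (@mpolyC c k) u) = u.
  by apply/rowP => i; rewrite !mxE mevalC.
have [|y yE] := gP (map_mx (@mpolyC c k) w).
  apply/rowP => i; rewrite [LHS]mxE subc [RHS]mxE.
  have -> : meval a ((map_mx (@mpolyC c k) w *m B) 0 i) = (w *m map_mx (meval
    a) B) 0 i.
    by rewrite -{2}[w]ev -map_mxM [RHS]mxE.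
  by rewrite wB mxE mpolyC0.
exists (g.@[a]^-1 *: map_mx (meval a) y).
have : map_mx (meval a) (g *: map_mx (@mpolyC c k) w - y *m B) = 0.
  apply/rowP => i; move/rowP: yE => /(_ i); rewrite [LHS]mxE subc [RHS]mxE =>
    /eqP.
  by rewrite mpolyC_eq0 => /eqP E; rewrite [LHS]mxE E mxE.
rewrite map_mxB map_mxZ ev map_mxM -scalemxAl => /eqP;
  rewrite subr_eq0 => /eqP <-.
by rewrite scalerA mulVf ?scale1r.
Qed.

(* Conversely, over k there is a contracting homotopy S at a; then
   U = B S + S B commutes with B, and det U kills the homology of B. *)
Lemma exact_at_annihilator :
  (forall w : 'rV_n, w *m map_mx (meval a) B = 0 ->
     exists y, y *m map_mx (meval a) B = w) ->
  exists2 h, h.@[a] = 1 & forall z : 'rV_n, z *m B = 0 -> exists y, y *m B = h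
    *: z.
Proof.
set b := map_mx (meval a) B => b_ex.
(* From b g b = b the rows of X are cycles, hence by exactness boundaries, so X g b = X and S = X g
   is the contraction. *)
pose g := pinvmx b; pose X := 1%:M - b *m g.
have bgb : b *m g *m b = b by exact: mulmxKpV.
have bb : b *m b = 0 by rewrite -map_mxM B_sq map_mx0.
have Xb : X *m b = 0 by rewrite mulmxBl mul1mx bgb subrr.
have XE : X *m g *m b = X.
  apply: mulmxKpV; apply/row_subP => i; have [|y <-] := b_ex (row i X).
    by rewrite -row_mul Xb row0.
  exact: submxMl.
pose S := X *m g.
have contr : b *m S + S *m b = 1%:M.
  have bX : b *m X = b by rewrite /X mulmxBr mulmx1 mulmxA bb mul0mx subr0.
  by rewrite XE /S mulmxA bX addrC subrK.
pose S1 := map_mx (@mpolyC c k) S; pose U := B *m S1 + S1 *m B.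
have Ua : map_mx (meval a) U = 1%:M.
  rewrite map_mxD !map_mxM -/b -contr.
  have -> // : map_mx (meval a) S1 = S.
  by apply/matrixP => i j; rewrite !mxE mevalC.
have BU : B *m U = U *m B.
  rewrite mulmxDr mulmxDl mulmxA B_sq mul0mx add0r -!mulmxA B_sq !mulmx0.
  by rewrite addr0.
have ha : (\det U).@[a] = 1 by rewrite -det_map_mx Ua det1.
exists (\det U) => // z zB.
have h_reg : GRing.lreg (\det U).
  apply/lregP; apply/eqP => h0; move: ha; rewrite h0 meval0 => /esym/eqP.
  by rewrite oner_eq0.
(* U commutes with B; multiplying by the regular element [\det U] transfers this to the adjugate. *)
have BA : B *m \adj U = \adj U *m B.
  apply: (scalemx_lreg h_reg); transitivity (\adj U *m (B *m U) *m \adj U).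
    by rewrite BU -mul_scalar_mx -mul_adj_mx !mulmxA.
  by rewrite -!mulmxA mul_mx_adj mul_mx_scalar scalemxAr.
exists (z *m S1 *m \adj U); rewrite -!mulmxA -BA.
have -> : z *m (S1 *m (B *m \adj U)) = z *m U *m \adj U.
  by rewrite [z *m U]mulmxDr !mulmxA zB mul0mx add0r.
by rewrite -mulmxA mul_mx_adj mul_mx_scalar.
Qed.

End EvaluationExact.

(** * The support set *)

Lemma total_presentation (A : pzRingType) (N : lmodType A) D n (deg : 'I_n -> nat)
    (T : 'M[A]_n) (e : 'I_n -> N) : total_resolution D deg T e ->
  let e0 (a : 'I_#|shamash_basis deg 0|) := e (enum_val a) in
  surjective (lin_val e0) /\ forall v, lin_val e0 v = 0 <->
    exists y, y *m (T *m (incl_mx A (shamash_basis deg 0))^T) = v.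
Proof.
move=> tP e0; set S0 := shamash_basis deg 0.
have S0E j : (j \in S0) = (deg j == 0%N) by rewrite inE leqn0; case: eqP => // ->.
have e0E v : lin_val e0 v = lin_val e (v *m incl_mx A S0).
  rewrite lin_val_mul; apply: eq_bigr => a _; congr (_ *: _).
  by rewrite row_incl_mx lin_val_delta.
have eS w : lin_val e (w *m (incl_mx A S0)^T *m incl_mx A S0) = lin_val e w.
  apply: eq_bigr => j _; rewrite incl_trE S0E; case: eqP => // /eqP j0.
  by rewrite (tr_gen0 tP) // !scaler0.
split=> [x|v].
  by have [w <-] := tr_gen tP x; exists (w *m (incl_mx A S0)^T); rewrite e0E eS.
rewrite e0E; split=> [|[y <-]]; last by rewrite mulmxA eS (tr_aug tP).
case/(tr_rel tP) => [j j0|y yE].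
  by apply: (@supported_incl _ _ S0); rewrite S0E.
by exists y; rewrite mulmxA yE incl_mxK.
Qed.

Lemma meval_map_mpoly (P : comNzRingType) (k : comNzRingType) (rho : {rmorphism
  P -> k})
    c (a : 'I_c -> k) (a' : 'I_c -> P) (p : {mpoly P[c]}) :
  (forall i, rho (a' i) = a i) -> (map_mpoly rho p).@[a] = rho p.@[a'].
Proof.
move=> a'E.
apply: (@mpoly_rmorph_ext _ _ _ (meval a \o map_mpoly rho) (rho \o meval a'))
  => [b|i] /=.
  by rewrite map_mpolyC !mevalC.
by rewrite map_mpolyX !mevalXU a'E.
Qed.

Lemma ftilde_meval (P : comNzRingType) c (f a' : 'I_c -> P) :
  (ftilde f).@[a'] = lin_comb f a'.
Proof.
rewrite rmorph_sum; apply: eq_bigr => i _.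
by rewrite rmorphM /= mevalXU mevalC.
Qed.

Lemma restrict_fin_gen (A B : pzRingType) (phi : {rmorphism A -> B}) (N :
  lmodType B) :
  surjective phi -> fin_gen N -> fin_gen (restrict N phi).
Proof.
move=> phi_surj [n [g gP]]; exists n, g => x; have [r ->] := gP x.
have [p pE] := choice (fun i => phi_surj (r i)).
by exists p; apply: eq_bigr => i _; rewrite -pE.
Qed.

Section Main.
Variables (P R : comNzRingType) (k : fieldType).
Variables (rho : {rmorphism P -> k}) (pi : {rmorphism P -> R}).
Hypothesis P_noetherian : noetherian P.
Hypothesis P_local : local_ring rho.
Hypothesis pi_surjective : surjective pi.
Variables (c : nat) (f : 'I_c -> P).
Hypothesis fI : forall i, pi (f i) = 0.
Hypothesis fn : forall i, rho (f i) = 0.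
Variable M : lmodType R.
Hypothesis M_fg : fin_gen M.

Let P_loc : forall x, rho x != 0 -> exists y, x * y = 1 := P_local.2.

Let MP : lmodType P := restrict M pi.

Let rho_lin a' : rho (lin_comb f a') = 0.
Proof. by rewrite rmorph_sum big1 // => i _; rewrite rmorphM fn mulr0. Qed.

Let MP_fg : fin_gen MP. Proof. exact: restrict_fin_gen. Qed.

Let MQ a' : lmodType (quot_ring (lin_comb f a')) := restrict M
  (hypersurface_map fI a').

Let MQ_scale a' p (x : M) :
  (quot_ring_pi (lin_comb f a') p *: (x : MQ a') : M) = p *: (x : MP).
Proof.
rewrite -[LHS]/(hypersurface_map fI a' (quot_ring_pi _ p) *: x).
by rewrite -[RHS]/(pi p *: x); congr (_ *: x); exact: quot_ring_factor_pi.
Qed.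

Let MQ_lin a' n (e : 'I_n -> M) (v : 'rV[P]_n) :
  lin_val (e : 'I_n -> MQ a') (map_mx (quot_ring_pi (lin_comb f a')) v) =
  lin_val (e : 'I_n -> MP) v.
Proof. by apply: eq_bigr => i _; rewrite mxE MQ_scale. Qed.

Let MQ_fg a' : fin_gen (MQ a').
Proof.
have [n [g gP]] := MP_fg; exists n, g => x; have [r rE] := gP x.
exists (fun i => quot_ring_pi (lin_comb f a') (r i)); rewrite [LHS]rE.
by apply: eq_bigr => i _; rewrite MQ_scale.
Qed.

(** The infinite case, in contrapositive form: over the hypersurface the minimal resolution is
    bounded, and the cone makes it at most one step longer. *)
Lemma finite_proj_dim_base a' : GRing.lreg (lin_comb f a') ->
  finite_proj_dim (MQ a') -> finite_proj_dim MP.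
Proof.
move=> fa_reg MQ_fin.
have Q_loc := @quot_ring_local P k rho P_loc _ (rho_lin a').
have Q_noeth := noetherian_quot_ring (x := lin_comb f a') P_noetherian.
have [r [d [e [dP d_min]]]] := minimal_resolution Q_loc Q_noeth (MQ_fg a').
have [m mP] := finite_proj_dim_Tor (quot_ring_factor (rho_lin a'))
  (row_resolution dP) MQ_fin.
have r0 n : (m <= n)%N -> r n.+1 = 0%N.
  by move=> /mP; exact: (minimal_resolution_Tor dP d_min).
have [|||r' [d' [e' [d'P r'0]]]] := @cone_resolution P (lin_comb f a') MP (MQ
  a') r d e
    (e : 'I_(r 0%N) -> M) fa_reg dP idfun.
- by exists idfun.
- by move=> v; exact: (esym (MQ_lin a' (e : 'I_(r 0) -> M) v)).
- by [].
apply: (row_resolution_finite d'P (m := m.+1)) => -[//|n] mn.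
by apply: r'0; [case: n mn => // n mn; apply: r0 | apply: r0; lia].
Qed.

Section FiniteProjDim.
(** This is the predecessor of the d of the theorem: the resolution of M over P has length at most
    [d.+1], and [Tor] in degree [d.+1] sits between the differentials of index [d] and [d.+1]. *)
Variable d : nat.
Hypothesis ftilde_reg : GRing.lreg (ftilde f).
Variables (n : nat) (deg : 'I_n -> nat) (T : 'M[P]_n) (e : 'I_n -> MP).
Hypothesis tP : total_resolution d.+1 deg T e.

Let T1 : 'M[{mpoly P[c]}]_n := map_mx (@mpolyC c P) T.

Let T1_homog i j : deg i != (deg j).+1 -> T1 i j = 0.
Proof. by move=> ij; rewrite mxE (tr_homog tP) // mpolyC0. Qed.

Let T1_exact (z : 'rV_n) : (forall j, deg j = 0%N -> z 0 j = 0) ->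
  z *m T1 = 0 -> exists y, y *m T1 = z.
Proof.
move=> z0; apply: (@mpoly_exact P c _ _ _ T T (fun j => deg j == 0%N)).
  by move=> y y0; apply: (tr_exact tP) => j /eqP; exact: y0.
by move=> j /eqP; exact: z0.
Qed.

(** Each f_j kills M, so f_j times a generator of degree 0 is a boundary; combining these boundaries
    with the variables as coefficients gives the datum that [higher_homotopies] requires for
    ftilde. *)
Lemma ftilde_homotopies : exists B : 'M[{mpoly P[c]}]_n,
  [/\ deg_ge deg 0 1 B, odd_degree deg B, deg_part deg 0 1 B = T1 &
      B *m B = (ftilde f)%:M].
Proof.
apply: higher_homotopies => //.
  by rewrite /T1 -map_mxM (tr_sq tP) map_mx0.
move=> i i0.
have /choice[y yE] : forall j, exists y : 'rV_n, y *m T = f j *: delta_mx 0 i.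
  move=> j; apply: (tr_rel tP) => [l l0|].
    by rewrite !mxE eqxx; case: eqP => [E|]; rewrite ?mulr0 //;
      rewrite E i0 in l0.
  rewrite linearZ /= lin_val_delta.
  by rewrite -[LHS]/(pi (f j) *: (e i : M)) fI scale0r.
exists (\sum_j 'X_j *: map_mx (@mpolyC c P) (y j)).
rewrite mulmx_suml scaler_suml; apply: eq_bigr => j _.
rewrite -scalemxAl -map_mxM yE -scalerA; congr (_ *: _).
by apply/rowP => l; rewrite !mxE rmorphM rmorph_nat.
Qed.

Variable B : 'M[{mpoly P[c]}]_n.
Hypothesis B_ge : deg_ge deg 0 1 B.
Hypothesis B_odd : odd_degree deg B.
Hypothesis B_part : deg_part deg 0 1 B = T1.
Hypothesis B_sq : B *m B = (ftilde f)%:M.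

Let Bk : 'M[{mpoly k[c]}]_n := map_mx (map_mpoly rho) B.

Let Bk_sq : Bk *m Bk = 0.
Proof. by rewrite -map_mxM B_sq map_scalar_mx /= ftilde_residue // raddf0. Qed.

Let Bk_odd : odd_degree deg Bk.
Proof. by move=> i j ij; rewrite mxE B_odd // raddf0. Qed.

Let exact_at a := forall w : 'rV_n, w *m map_mx (meval a) Bk = 0 ->
  exists y, y *m map_mx (meval a) Bk = w.

Lemma Qtilde_resolution : exists (F : projective_resolution (Qtilde_module fI M)),
  forall h, Tor_annihilator fn F d.+1 h <->
    (forall z : 'rV_n, z *m Bk = 0 -> exists y, y *m Bk = h *: z).
Proof.
have [e_surj e_rel] := total_presentation tP.
have [e1_surj e1_rel] := base_change_presentation (@mpolyC c P) e_surj e_rel.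
set e1 := (fun i : 'I__ => base_change_in _ _) in e1_surj e1_rel.
pose eQ : 'I_#|shamash_basis deg 0| -> Qtilde_module fI M := e1.
have eQE v : lin_val eQ (map_mx (quot_ring_pi (ftilde f)) v) = lin_val e1 v.
  by apply: eq_bigr => i _; rewrite mxE; exact: over_quot_scale_pi.
have FP := @shamash_resolution n deg _ T1 B (ftilde f) ftilde_reg T1_homog
  T1_exact
  B_ge B_odd B_part B_sq _ eQ.
have {}FP : matrix_resolution
    (fun m => map_mx (quot_ring_pi (ftilde f)) (shamash_diff deg B m)) eQ.
  apply: FP => [y|v]; first by have [v <-] := e1_surj y; exists v; rewrite eQE.
  by rewrite eQE e1_rel map_mxM -matrix.map_trmx map_incl_mx.
exists (row_resolution FP) => h.
have dE m : map_mx (Qtilde_residue fn) (map_mx (quot_ring_pi (ftilde f))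
  (shamash_diff deg B m)) =
    shamash_diff deg Bk m.
  rewrite -(map_shamash_diff _ (map_mpoly rho)); apply/matrixP => i j.
  by rewrite !mxE; exact: quot_ring_factor_pi.
rewrite -(shamash_homology h (tr_deg tP) Bk_odd (leqnn d.+1)).
have annB m : annihilator (Tor (Qtilde_residue fn) (row_resolution FP) m.+1) h <->
    forall z : 'rV_#|shamash_basis deg m.+1|, z *m shamash_diff deg Bk m = 0 ->
      exists y, y *m shamash_diff deg Bk m.+1 = h *: z.
  by rewrite -!dE; exact: annihilator_Tor_row.
rewrite -!annB; split=> [hJ|[h0 h1] [u v]].
  by split=> [u|v]; [exact: (congr1 fst (hJ (u, 0))) | exact: (congr1 snd (hJ
    (0, v)))].
by apply: (congr2 pair); [exact: h0 | exact: h1].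
Qed.

(** Two resolutions share the work: Shamash's computes Tor, which is periodic from degree [d.+1] on,
    so that vanishing far out amounts to exactness at a; the minimal one turns that vanishing into
    finite length. *)
Lemma finite_proj_dim_exact a a' : lifting rho f a a' ->
  finite_proj_dim (MQ a') <-> exact_at a.
Proof.
move=> [a'E fa_reg]; pose x := lin_comb f a'.
pose Ba := map_mx (meval a') B.
have T1a : map_mx (meval a') T1 = T by apply/matrixP => i j; rewrite !mxE mevalC.
have Ba_ge : deg_ge deg 0 1 Ba by move=> i j ij; rewrite mxE B_ge ?meval0.
have Ba_odd : odd_degree deg Ba by move=> i j ij; rewrite mxE B_odd ?meval0.
have Ba_part : deg_part deg 0 1 Ba = T.
  rewrite -T1a -B_part; apply/matrixP => i j; rewrite !mxE.
  by case: ifP; rewrite ?meval0.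
have Ba_sq : Ba *m Ba = x%:M.
  by rewrite -map_mxM B_sq map_scalar_mx /= ftilde_meval.
have [e_surj e_rel] := total_presentation tP.
pose eQ (i : 'I_#|shamash_basis deg 0|) : MQ a' := e (enum_val i).
have FP : matrix_resolution (fun m => map_mx (quot_ring_pi x) (shamash_diff deg
  Ba m)) eQ.
  apply: (shamash_resolution fa_reg (tr_homog tP) (tr_exact tP) Ba_ge Ba_odd
    Ba_part Ba_sq).
    by move=> y; have [v <-] := e_surj y; exists v; exact: MQ_lin.
  by move=> v; rewrite -e_rel; split=> E; rewrite -E; [apply: esym|];
    exact: MQ_lin.
have rhoQ_loc := @quot_ring_local P k rho P_loc _ (rho_lin a').
pose rhoQ : {rmorphism quot_ring x -> k} := quot_ring_factor (rho_lin a').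
have dE m : map_mx rhoQ (map_mx (quot_ring_pi x) (shamash_diff deg Ba m)) =
    shamash_diff deg (map_mx (meval a) Bk) m.
  rewrite 2!map_shamash_diff; congr (shamash_diff deg _ m).
  apply/matrixP => i j; rewrite !mxE (meval_map_mpoly _ a'E).
  exact: quot_ring_factor_pi.
have Bka_odd : odd_degree deg (map_mx (meval a) Bk).
  by move=> i j ij; rewrite mxE Bk_odd ?meval0.
have ann_exact m : (d <= m)%N ->
    annihilator (Tor rhoQ (row_resolution FP) m.+1) 1 /\
    annihilator (Tor rhoQ (row_resolution FP) m.+2) 1 <-> exact_at a.
  move=> dm; rewrite !annihilator_Tor_row !dE.
  have := shamash_homology 1 (tr_deg tP) Bka_odd (dm : (d.+1 <= m.+1)%N).
  move=> /= ->; split=> h w /h[y yE]; exists y; first by rewrite yE scale1r.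
  by rewrite yE scale1r.
split=> [MQ_fin|ex].
  have [m mP] := finite_proj_dim_Tor rhoQ (row_resolution FP) MQ_fin.
  by apply/(ann_exact (maxn d m)); [exact: leq_maxl | split; apply: mP; lia].
have Q_noeth := noetherian_quot_ring (x := x) P_noetherian.
have [r [dQ [e' [dP d_min]]]] := minimal_resolution rhoQ_loc Q_noeth (MQ_fg a').
apply: (row_resolution_finite dP (m := d)) => -[//|m] dm.
apply: (minimal_resolution_Tor dP d_min).
by have [] := (ann_exact m dm).2 ex; eauto.
Qed.

Lemma annihilator_support a (J : {mpoly k[c]} -> Prop) :
  (exists a', lifting rho f a a') ->
  (forall h, J h <-> (forall z : 'rV_n, z *m Bk = 0 -> exists y, y *m Bk = h *:
    z)) ->
  support_set rho fI M a <-> (forall h, J h -> h.@[a] = 0).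
Proof.
move=> [a0 a0P] JE; split=> [[a' [a'P MQ_inf]] h /JE hJ|Ja].
  apply/eqP/negPn/negP => ha; apply: MQ_inf; apply/(finite_proj_dim_exact a'P).
  exact: (exact_eval Bk_sq ha hJ).
exists a0; split=> // /(finite_proj_dim_exact a0P)/(exact_at_annihilator Bk_sq).
by move=> [h ha /JE/Ja/eqP]; rewrite ha oner_eq0.
Qed.
End FiniteProjDim.
End Main.

(** This makes d positive, so that both Tor modules fall under the successor case of [Tor]. *)
Lemma depth_gt0 (P : comNzRingType) (k : fieldType) (rho : {rmorphism P -> k})
  e x :
  is_depth rho e -> GRing.lreg x -> rho x = 0 -> (0 < e)%N.
Proof.
move=> [_ e_max] x_reg x0; apply: (e_max [:: x]); split; last first.
  by move=> y; rewrite inE => /eqP ->.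
apply: (@regular_sequence_cons P x [::]) => //; split=> // -[g].
rewrite big1 => [|[]//]; move/(congr1 (quot_ring_factor x0)).
by rewrite rmorph1 rmorph0 => /eqP; rewrite oner_eq0.
Qed.

(** Descending induction from where Tor vanishes: a last nonzero rank in degree n + 1 > e would give
    a regular sequence of length n + 1. *)
Lemma minimal_resolution_length (P : comNzRingType) (k : fieldType)
    (rho : {rmorphism P -> k}) e (N : lmodType P) (r : nat -> nat)
    (d : forall n, 'M[P]_(r n.+1, r n)) (g : 'I_(r 0) -> N) :
  noetherian P -> local_ring rho -> is_depth rho e ->
  matrix_resolution d g -> (forall n i j, rho (d n i j) = 0) ->
  finite_proj_dim N -> forall n, (e < n)%N -> r n = 0%N.
Proof.
move=> P_noeth [_ P_loc] [_ e_max] dP d_min N_fin.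
have [m mP] := finite_proj_dim_Tor rho (row_resolution dP) N_fin.
suff r0 l n : (e <= n)%N -> (m <= n + l)%N -> r n.+1 = 0%N.
  by case=> // n en; apply: (r0 m); rewrite ?leq_addl.
elim: l n => [|l IHl] n en mn.
  by apply: (minimal_resolution_Tor dP d_min); apply: mP; rewrite -(addn0 n).
apply/eqP/negPn/negP; rewrite -lt0n => rn.
have rn1 : r n.+2 = 0%N by apply: IHl; [exact: leqW | rewrite addSnnS].
have [xs [xs_reg xs0 xsE]] := auslander_buchsbaum P_noeth P_loc (mr_exact dP)
  rn rn1 d_min.
by have := e_max xs (conj xs_reg xs0); rewrite xsE ltnNge en.
Qed.

Theorem theorem3p9 (P R : comNzRingType) (k : closedFieldType)
    (rho : {rmorphism P -> k}) (pi : {rmorphism P -> R})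
    (P_noetherian : noetherian P) (P_local : local_ring rho)
    (pi_surjective : surjective pi)
    (I_max : forall x, pi x = 0 -> rho x = 0)
    (I_regular : exists2 x, pi x = 0 & GRing.lreg x)
    (c : nat) (f : 'I_c -> P)
    (f_gen : minimal_generators (fun x => pi x = 0) f)
    (depthP d : nat) (P_depth : is_depth rho depthP) (d_ge : (depthP <= d)%N)
    (M : lmodType R) (M_fg : fin_gen M) :
  let fI := minimal_generators_in f_gen in
  let fn := fun i => I_max (f i) (fI i) in
  [/\ ~ finite_proj_dim (restrict M pi) ->
        forall a, support_set rho fI M a,
      finite_proj_dim (restrict M pi) ->
        forall (F : projective_resolution (Qtilde_module fI M)) a,
          support_set rho fI M a <->
          (forall h, Tor_annihilator fn F d h -> h.@[a] = 0)
    & zariski_closed (support_set rho fI M)].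
Proof.
move=> fI fn.
have [x x_ker x_reg] := I_regular.
have lift_ex a : exists a', lifting rho f a a'.
  by apply: (lifting_exists P_noetherian P_local fn x_reg); apply/f_gen.1.
have inf_case : ~ finite_proj_dim (restrict M pi) ->
    forall a, support_set rho fI M a.
  move=> M_inf a; have [a' a'P] := lift_ex a; exists a'; split=> // MQ_fin.
  exact: M_inf (finite_proj_dim_base P_noetherian P_local pi_surjective fn M_fg
    a'P.2 MQ_fin).
have d_gt0 : (0 < d)%N.
  exact: leq_trans (depth_gt0 P_depth x_reg (I_max _ x_ker)) d_ge.
case: d d_gt0 d_ge => // d _ d_ge.
have fin_case : finite_proj_dim (restrict M pi) ->
    exists F0 : projective_resolution (Qtilde_module fI M), forall a,
      support_set rho fI M a <->
      (forall h, Tor_annihilator fn F0 d.+1 h -> h.@[a] = 0).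
  move=> M_fin.
  have MP_fg : fin_gen (restrict M pi).
    exact: restrict_fin_gen.
  have [r [D [e [DP D_min]]]] := minimal_resolution P_local.2 P_noetherian MP_fg.
  have r0 n : (d.+1 < n)%N -> r n = 0%N.
    move=> dn; apply: (minimal_resolution_length P_noetherian P_local P_depth
      DP D_min) => //.
    exact: leq_ltn_trans dn.
  have [n [deg [T [g tP]]]] := total_resolution_exists DP r0.
  (* A lifting of the origin is a point of P^c at which ftilde takes a regular value. *)
  have ft_reg : GRing.lreg (ftilde f).
    have [a' [_ a'_reg]] := lift_ex (fun=> 0).
    by apply: (lreg_meval (a := a')); rewrite ftilde_meval.
  have [B [B_ge B_odd B_part B_sq]] := ftilde_homotopies fI tP.
  have [F0 F0E] := Qtilde_resolution fI fn ft_reg tP B_ge B_odd B_part B_sq.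
  exists F0 => a.
  by apply: (annihilator_support P_noetherian P_local pi_surjective fI fn M_fg
    tP B_ge B_odd B_part B_sq).
(* The equality was obtained for one constructed resolution and has to hold for an arbitrary one. *)
have Tor_indep (F G : projective_resolution (Qtilde_module fI M)) h :
    Tor_annihilator fn F d.+1 h -> Tor_annihilator fn G d.+1 h.
  move=> hF [u v]; apply: (congr2 pair).
    apply: (annihilator_Tor_indep (F := F)) => {}u;
      exact: (congr1 fst (hF (u, 0))).
  apply: (annihilator_Tor_indep (F := F)) => {}v; exact: (congr1 snd (hF (0, v))).
split=> [//|M_fin F a|].
  have [F0 F0P] := fin_case M_fin; rewrite F0P.
  by split=> J0 h hF; apply: J0; exact: Tor_indep hF.
have [/fin_case[F0 F0P]|/inf_case M_inf] := pselect (finite_proj_dim (restrict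
  M pi)).
  by exists (Tor_annihilator fn F0 d.+1).
by exists (fun=> False).
Qed.
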